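(* There exists an absolute constant $d_0\ge 3$ such that the following holds. Let $\alpha>48$ and $\beta\ge \frac{16}{9}(\sqrt{12}+2\sqrt{\alpha})^2$. Then there is a constant $C>0$, depending only on $\alpha$ and $\beta$ (in particular not on $d,s,\sigma$), such that for all integers $d\ge d_0$, all $\sigma>0$ and all $s\in\{1,\dots,d\}$, the estimator $\hat L$ (defined in the context with tuning parameters $\alpha,\beta$) satisfies $$\sup_{\theta\in\Theta_s}\mathbf{E}_\theta\big(\hat L-L(\theta)\big)^2\le C\,\sigma^2s^2\log\Big(1+\frac{d\log d}{s^2}\Big).$$
   Context: Model: one observes $y=(y_1,\dots,y_d)$ with $y_j=\theta_j+\sigma\xi_j$, $j=1,\dots,d$, where $\theta=(\theta_1,\dots,\theta_d)\in\mathbb{R}^d$ is unknown, $\xi_j$ are i.i.d. standard normal random variables and $\sigma>0$ is known; $\mathbf{E}_\theta$ is the expectation under the law $\mathbf{P}_\theta$ of $y$. $L(\theta)=\sum_{i=1}^d\theta_i$. For $s\in\{1,\dots,d\}$, $\Theta_s=\{\theta\in\mathbb{R}^d:\|\theta\|_0\le s\}$, where $\|\theta\|_0$ is the number of nonzero components of $\theta$. $\log$ is the natural logarithm, $\mathbf 1$ denotes an indicator. Estimator. For $s=1,\dots,d$ set $$\hat L_s=\begin{cases}\sum_{j=1}^d y_j\,\mathbf 1_{\{y_j^2>\alpha\sigma^2\log(1+d(\log d)/s^2)\}}, & s\le\sqrt{d\log d/2},\\ \sum_{j=1}^d y_j,&\text{otherwise,}\end{cases}$$ and let $\omega_s>0$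 be given by $\omega_s^2=\beta\sigma^2s^2\log(1+d(\log d)/s^2)$. Define $$\hat s=\min\Big\{s\in\{1,\dots,\lfloor\sqrt{d\log d/2}\rfloor\}:\ |\hat L_s-\hat L_{s'}|\le\omega_{s'}\ \text{for all } s'\in\{s+1,\dots,d\}\Big\},$$ with the convention $\hat s=\lfloor\sqrt{d\log d/2}\rfloor+1$ if this set is empty. Finally $\hat L=\hat L_{\hat s}$. (Here $\sqrt{d\log d/2}$ means $\sqrt{(d\log d)/2}$.) *)

(* Defs.v *)
From HB Require Import structures.
From mathcomp Require Import all_boot all_order all_algebra.
From mathcomp Require Import all_classical all_reals all_analysis.

Set Implicit Arguments.
Unset Strict Implicit.
Unset Printing Implicit Defensive.

Import Order.TTheory GRing.Theory Num.Theory.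
Import numFieldNormedType.Exports.

Local Open Scope classical_set_scope.
Local Open Scope ring_scope.

Section Noise.
Context {disp : measure_display} {T : measurableType disp} {R : realType}.
Variables (P : probability T R) (d : nat).
Implicit Type X : 'I_d -> {RV P >-> R}.

Definition mutually_independent X : Prop :=
  forall (J : {set 'I_d}) (A : 'I_d -> set R),
    (forall j, measurable (A j)) ->
    P (\bigcap_(j in [set` J]) X j @^-1` A j) =
    (\prod_(j in J) P (X j @^-1` A j))%E.

(* The second parameter of normal_prob is the standard deviation. *)
Definition iid_standard_normal X : Prop :=
  mutually_independent X /\
  forall j (A : set R), measurable A ->
    distribution P (X j) A = normal_prob 0 1 A.

Definition observation (theta : 'rV[R]_d) (sigma : R) X (w : T) : 'rV[R]_d :=
  \row_j (theta 0 j + sigma * X j w).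

End Noise.

Section Estimator.
Context {R : realType} {d : nat}.
Implicit Types (theta y : 'rV[R]_d) (alpha beta sigma : R) (s : nat).

Definition lin_fun theta : R := \sum_(j < d) theta 0 j.

Definition norm0 theta : nat := #|[set j | theta 0 j != 0]%SET|.

Definition sparse_class s : set 'rV[R]_d := [set theta | (norm0 theta <= s)%N].

Definition log_factor (n s : nat) : R :=
  ln (1 + n%:R * ln n%:R / s%:R ^+ 2).

Definition sparsity_cutoff (n : nat) : R := Num.sqrt (n%:R * ln n%:R / 2).

Definition Lhat_at alpha sigma y s : R :=
  if s%:R <= sparsity_cutoff d then
    \sum_(j < d | y 0 j ^+ 2 > alpha * sigma ^+ 2 * log_factor d s) y 0 j
  else \sum_(j < d) y 0 j.

Definition omega beta sigma s : R :=
  Num.sqrt (beta * sigma ^+ 2 * s%:R ^+ 2 * log_factor d s).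

Definition admissible alpha beta sigma y s : bool :=
  all (fun s' => `|Lhat_at alpha sigma y s - Lhat_at alpha sigma y s'|
                   <= omega beta sigma s')
      (index_iota s.+1 d.+1).

(* The candidates are listed in increasing order, so the head is the minimum;
   the default value of head is the convention for the empty set. *)
Definition shat alpha beta sigma y : nat :=
  let N := Num.truncn (sparsity_cutoff d) in
  head N.+1 [seq s <- index_iota 1 N.+1 | admissible alpha beta sigma y s].

Definition Lhat alpha beta sigma y : R :=
  Lhat_at alpha sigma y (shat alpha beta sigma y).

End Estimator.

(* Main.v *)
Require Import Defs.
From HB Require Import structures.
From mathcomp Require Import all_boot all_order all_algebra.
From mathcomp Require Import all_classical all_reals all_analysis.
From mathcomp Require Import measurable_realfun ring lra.
Import Order.TTheory GRing.Theory Num.Theory.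
Import numFieldNormedType.Exports.
Local Open Scope classical_set_scope.
Local Open Scope ring_scope.

(** Write [L s] for [log_factor d s], [N] for the integer part of the cutoff and
    [W] for the sum of the noise variables, and rescale to [sigma = 1].
    - Comparing with the untruncated estimator, the squared error is always at
      most [2 * beta * d * ln d + 2 * W ^+ 2]. For [s > N] this is enough, since
      then [s ^+ 2 * L s >= d * ln d / 2].
    - For [s <= N], if [s] is admissible then the selected index is at most [s],
      and the error is that of the estimator thresholded at [s] plus [omega s].
    - If [s] is not admissible, some [s' > s] has an estimator at distance more
      than [omega s'] from that of [s], and all [s' > N] give the same estimator.
      By monotonicity of [s ^+ 2 * L s] and the choice of [beta], the signal
      accounts for only a part of this distance, so a sum of truncated noise
      variables exceeds [16 * s' * sqrt (L s')]. Such an event has probability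
      at most [2 / d ^+ 3], or [2 / d ^+ 2] if [s' = N + 1]; this absorbs the
      crude bound.
    The tail bounds are Chernoff bounds. An odd truncation [q] of a standard
    normal variable satisfies [E expR (l * q) = E cosh (l * q)], which is at most
    [1 + O(l ^+ 2)], with a gain of [expR (- 2 * L s)] when [q] vanishes below the
    threshold, as [alpha > 48]. Probabilities are never used: each event is
    dominated by an exponential. *)

(** * Integrals of nonnegative functions and change of measure *)

Section IntegralTools.
Context {d1 d2 : measure_display} {T1 : measurableType d1}
  {T2 : measurableType d2} {R : realType}.
Local Open Scope ereal_scope.
Import HBNNSimple.

(** The integral of a nonnegative function is the supremum over the simple functions below it, and
    this family grows with the function. It serves to bound the squared error, whose measurability
    is never established, by a measurable function. *)
Lemma ge0_le_integral_nonmeasurable (mu : {measure set T1 -> \bar R})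
    (f1 f2 : T1 -> \bar R) :
  (forall x, 0 <= f1 x) -> (forall x, f1 x <= f2 x) ->
  \int[mu]_x f1 x <= \int[mu]_x f2 x.
Proof.
move=> f10 f12.
have f20 x : 0 <= f2 x by rewrite (le_trans (f10 x)).
rewrite !ge0_integralTE//; apply: le_ereal_sup => _ /= [h hf1 <-].
by exists h => // x; rewrite (le_trans (hf1 x)).
Qed.

(* Density formula and image measure in one: it suffices to check indicator
   functions [f]. *)
Lemma ge0_integral_comp_density (mu : {measure set T1 -> \bar R})
    (nu : {measure set T2 -> \bar R}) (X : T1 -> T2) (g : T1 -> R) (c : R) :
  measurable_fun setT X -> measurable_fun setT g -> (forall x, 0 <= g x)%R ->
  (0 <= c)%R ->
  (forall A, measurable A ->
    \int[mu]_x (\1_A (X x) * g x)%:E = c%:E * nu A) ->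
  forall f : T2 -> R, measurable_fun setT f -> (forall y, 0 <= f y)%R ->
  \int[mu]_x (f (X x) * g x)%:E = c%:E * \int[nu]_y (f y)%:E.
Proof.
move=> mX mg g0 c0 H f mf f0.
have mE : measurable_fun setT (EFin \o f) by exact/measurable_EFinP.
pose h := nnsfun_approx measurableT mE.
have hcvg y : EFin \o h^~ y @ \oo --> (f y)%:E.
  by apply: (@cvg_nnsfun_approx _ _ _ _ measurableT _ mE) => // t _; rewrite lee_fin.
have hnd a b y : (a <= b)%N -> (h a y <= h b y)%R.
  by move=> ab; exact/lefP/nd_nnsfun_approx.
have mhX n : measurable_fun setT (fun x => h n (X x)).
  by apply: measurableT_comp.
have -> : \int[mu]_x (f (X x) * g x)%:E =
    lim (\int[mu]_x (h n (X x) * g x)%:E @[n --> \oo]).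
  have e x : (f (X x) * g x)%:E = lim ((h n (X x) * g x)%:E @[n --> \oo]).
    apply/esym/cvg_lim => //; rewrite EFinM.
    under eq_fun do rewrite EFinM.
    by apply: cvgeZr => //; exact: hcvg.
  under eq_integral => x _ do rewrite e.
  apply: monotone_convergence => //.
  - by move=> n; apply/measurable_EFinP/measurable_funM.
  - by move=> n x _; rewrite lee_fin mulr_ge0.
  - by move=> x _ a b ab; rewrite lee_fin ler_wpM2r// hnd.
have intf : \int[nu]_y (h n y)%:E @[n --> \oo] --> \int[nu]_y (f y)%:E.
  have e y : (f y)%:E = lim ((h n y)%:E @[n --> \oo]).
    by apply/esym/cvg_lim => //; exact: hcvg.
  under [X in _ --> X]eq_integral => y _ do rewrite e.
  apply: cvg_monotone_convergence => //.
  - by move=> n; exact/measurable_EFinP.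
  - by move=> n y _; rewrite lee_fin.
  - by move=> y _ a b ab; rewrite lee_fin hnd.
have <- : lim (c%:E * \int[nu]_y (h n y)%:E @[n --> \oo]) =
    c%:E * \int[nu]_y (f y)%:E.
  by apply/cvg_lim => //; exact: cvgeZl.
suff suf n : \int[mu]_x (h n (X x) * g x)%:E = c%:E * \int[nu]_y (h n y)%:E.
  by under eq_fun do rewrite suf.
have mind r (A : set T2) : measurable A ->
    measurable_fun setT (fun x => (r * (\1_A (X x) * g x))%:E : \bar R).
  move=> mA; apply/measurable_EFinP/measurable_funM => //.
  by apply: measurable_funM => //; exact: measurableT_comp.
(* Splitting a simple function along its finitely many values reduces the claim to [H] on each level
   set. *)
transitivity (\int[mu]_x (\sum_(y \in range (h n))
    (y * (\1_(h n @^-1` [set y]) (X x) * g x))%:E)).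
  apply: eq_integral => x _; rewrite (fimfunE _ (X x)) fsumEFin//.
  congr EFin; rewrite mulrC mulr_fsumr//.
  by apply: eq_fsbigr => y _; rewrite mulrC mulrA.
rewrite ge0_integral_fsum//; last 2 first.
  - by move=> y; exact: mind.
  - move=> y x _; rewrite mulrA EFinM mule_ge0 ?lee_fin//.
    exact: nnfun_muleindic_ge0.
transitivity (\sum_(y \in range (h n)) (y%:E * (c%:E * nu (h n @^-1` [set y])))).
  apply: eq_fsbigr => y /[!inE] -[t _ <-].
  under eq_integral do rewrite EFinM.
  rewrite ge0_integralZl//; last 3 first.
  - apply/measurable_EFinP/measurable_funM => //.
    by apply: measurableT_comp.
  - by move=> x _; rewrite lee_fin mulr_ge0.
  - by rewrite lee_fin.
  by rewrite H.
rewrite integral_nnsfun// patch_setT sintegralE.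
rewrite ge0_mule_fsumr.
  by apply: eq_fsbigr => y _; rewrite muleCA.
by move=> y; exact: nnsfun_mulemu_ge0.
Qed.
End IntegralTools.

(** * Expectations of products of independent factors *)

Section IndependentProducts.
Context {disp : measure_display} {T : measurableType disp} {R : realType}.
Context {P : probability T R} {d : nat}.
Variable X : 'I_d -> {RV P >-> R}.
Hypothesis indepX : mutually_independent X.
Local Open Scope ereal_scope.

(** Indicators are turned into the functions [f j] one coordinate at a time, [s] listing the
    coordinates already treated. With [s] empty this is the definition of independence. *)
Let integral_prod_mixed (f : 'I_d -> R -> R) (m : 'I_d -> R) :
  (forall j, measurable_fun setT (f j)) -> (forall j x, 0 <= f j x)%R ->
  (forall j, \int[P]_w (f j (X j w))%:E = (m j)%:E) ->
  forall (s : seq 'I_d) (A : 'I_d -> set R), uniq s ->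
  (forall j, measurable (A j)) ->
  \int[P]_w (\prod_j (if j \in s then f j (X j w) else \1_(A j) (X j w)))%:E =
  (\prod_j (if j \in s then m j else fine (P (X j @^-1` A j))))%:E.
Proof.
move=> mf f0 fm; elim=> [|i s IH] A us mA.
  transitivity (P (\bigcap_(j in [set` [set: 'I_d]%SET]) X j @^-1` A j)).
    rewrite -[X in _ = P X]setIT -integral_indic//; last first.
      apply: fin_bigcap_measurable => //= j _.
      by rewrite -[X in measurable X]setTI; exact: measurable_funP.
    apply: eq_integral => w _; congr EFin.
    rewrite indicE; have [/forallP H|/forallPn[j jA]] :=
        boolP [forall j, X j w \in A j].
      rewrite mem_set ?big1// => [j _|j _ /=]; last exact/set_mem/H.
      by rewrite indicE H.
    rewrite (bigD1 j)//= indicE (negbTE jA) mul0r memNset// => /(_ j)/=.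
    by rewrite inE => /(_ isT); apply: contraNnot jA => /mem_set.
  rewrite indepX// -prodEFin (eq_bigl xpredT) => [|j]; last by rewrite inE.
  apply: eq_bigr => j _; rewrite fineK// fin_num_measure//.
  by rewrite -[X in measurable X]setTI; exact: measurable_funP.
move: us => /= /andP[iNs us].
rewrite (bigD1 i)//= mem_head.
have e w : (\prod_j (if j \in i :: s then f j (X j w) else \1_(A j) (X j w)) =
  f i (X i w) * \prod_(j | j != i) (if j \in s then f j (X j w) else \1_(A j) (X j w)))%R.
  rewrite (bigD1 i)//= mem_head; congr (_ * _)%R.
  by apply: eq_bigr => j ji; rewrite inE (negbTE ji).
under eq_integral do rewrite e.
have -> : (\prod_(j < d | j != i)
      (if j \in i :: s then m j else fine (P (X j @^-1` A j))))%R =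
  (\prod_(j < d | j != i)
      (if j \in s then m j else fine (P (X j @^-1` A j))))%R.
  by apply: eq_bigr => j ji; rewrite inE (negbTE ji).
have m0 j : (0 <= m j)%R.
  by rewrite -lee_fin -fm integral_ge0// => w _; rewrite lee_fin.
(* The other factors act as a density. The induction hypothesis, used with an arbitrary set [B] at
   the coordinate [i], shows that [X i] pushes the weighted measure to a constant multiple of its
   law. *)
rewrite (ge0_integral_comp_density P (distribution P (X i)) (X i)
  (fun w => \prod_(j | j != i) (if j \in s then f j (X j w) else \1_(A j) (X j w)))%R
  (\prod_(j < d | j != i)
      (if j \in s then m j else fine (P (X j @^-1` A j))))%R)//.
- rewrite ge0_integral_distribution//.
  + by rewrite fm -EFinM mulrC.
  + exact/measurable_EFinP.
  + by move=> y; rewrite lee_fin.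
- under eq_fun do rewrite -big_filter.
  apply: measurable_prod => j _; case: (j \in s).
    exact: measurableT_comp.
  by apply: measurableT_comp.
- by move=> w; apply: prodr_ge0 => j _; case: ifP.
- by apply: prodr_ge0 => j _; case: ifP => // _; rewrite fine_ge0.
- move=> B mB.
  pose A' j := if j == i then B else A j.
  have mA' j : measurable (A' j) by rewrite /A'; case: ifP.
  have A'i : A' i = B by rewrite /A' eqxx.
  have := IH A' us mA'.
  rewrite [X in _ = (X)%:E -> _](bigD1 i)//= (negbTE iNs) A'i => IHA.
  transitivity (\int[P]_w
      (\prod_j (if j \in s then f j (X j w) else \1_(A' j) (X j w)))%:E).
    apply: eq_integral => w _; rewrite [in RHS](bigD1 i)//= (negbTE iNs).
    rewrite A'i; congr (_ * _)%:E; apply: eq_bigr => j ji.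
    by rewrite /A' (negbTE ji).
  rewrite IHA mulrC EFinM fineK ?fin_num_measure//; last first.
    by rewrite -[X in measurable X]setTI; exact: measurable_funP.
  congr (_%:E * _); apply: eq_bigr => j ji.
  by rewrite /A' (negbTE ji).
Qed.

Lemma expectation_prod (f : 'I_d -> R -> R) (m : 'I_d -> R) :
  (forall j, measurable_fun setT (f j)) -> (forall j x, 0 <= f j x)%R ->
  (forall j, \int[P]_w (f j (X j w))%:E = (m j)%:E) ->
  \int[P]_w (\prod_j f j (X j w))%:E = (\prod_j m j)%:E.
Proof.
move=> mf f0 fm.
have := integral_prod_mixed _ _ mf f0 fm (enum 'I_d) (fun=> setT) (enum_uniq _).
move=> /(_ (fun=> measurableT)) e.
transitivity (\int[P]_w (\prod_j (if j \in enum 'I_d then f j (X j w)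
    else \1_setT (X j w)))%:E).
  apply: eq_integral => w _; congr EFin.
  by apply: eq_bigr => j _; rewrite mem_enum.
rewrite e; congr EFin.
by apply: eq_bigr => j _; rewrite mem_enum.
Qed.

End IndependentProducts.

(** * Exponential moments of odd functions of a standard normal variable *)

Section GaussianMoments.
Context {R : realType}.
Local Open Scope ereal_scope.

Lemma integral_normal_prob (f : R -> R) :
  measurable_fun setT f -> (forall x, 0 <= f x)%R ->
  \int[normal_prob 0 1]_x (f x)%:E =
  \int[lebesgue_measure]_x (f x * normal_pdf 0 1 x)%:E.
Proof.
move=> mf f0.
rewrite (ge0_integral_comp_density lebesgue_measure (normal_prob 0 1) id
  (normal_pdf 0 1) 1)//.
- by rewrite mul1e.
- exact: measurable_normal_pdf.
- by move=> x; exact: normal_pdf_ge0.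
move=> A mA; rewrite mul1e /normal_prob [RHS]integral_mkcond.
apply: eq_integral => x _; rewrite /patch indicE.
by case: (x \in A); rewrite ?mul1r ?mul0r.
Qed.

(* [expR (x ^+ 2 / 4)] times the standard normal density is [sqrt 2] times
   the centred normal density of variance 2. *)
Lemma normal_exp_sqr_moment :
  \int[normal_prob 0 1]_x (expR (x ^+ 2 / 4))%:E = (Num.sqrt 2 : R)%:E.
Proof.
rewrite integral_normal_prob//; last first.
  apply: measurableT_comp => //; apply: measurable_funM => //.
have s20 : (Num.sqrt 2 != 0 :> R)%R by rewrite gt_eqF// sqrtr_gt0.
transitivity (\int[@lebesgue_measure R]_x ((Num.sqrt 2)%:E * (normal_pdf 0 (Num.sqrt 2) x)%:E)).
  apply: eq_integral => x _; rewrite -EFinM; congr EFin.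
  rewrite !normal_pdfE ?oner_neq0// /normal_peak /normal_fun.
  rewrite sqr_sqrtr// !subr0 expr1n mul1r.
  rewrite mulrCA -expRD mulrA.
  rewrite -(mulrnAr 2 pi 2).
  rewrite sqrtrM// invfM mulrA divff// mul1r.
  by congr (_ * expR _)%R; field.
rewrite ge0_integralZl//.
- by rewrite integral_normal_pdf mule1.
- by apply/measurable_EFinP; exact: measurable_normal_pdf.
- by move=> x _; rewrite lee_fin normal_pdf_ge0.
Qed.

Lemma integral_lebesgueN (f : R -> R) :
  measurable_fun setT f -> (forall x, 0 <= f x)%R ->
  \int[lebesgue_measure]_x (f (- x)%R)%:E = \int[lebesgue_measure]_x (f x)%:E.
Proof.
move=> mf f0; transitivity (\int[@lebesgue_measure R]_x (f (- x) * 1)%:E).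
  by apply: eq_integral => x _; rewrite mulr1.
rewrite (ge0_integral_comp_density lebesgue_measure lebesgue_measure -%R
  (cst 1%R) 1)// ?mul1e// => A mA.
rewrite mul1e -[RHS]lebesgue_measureN//.
under eq_integral do rewrite mulr1.
have mNA : measurable (-%R @^-1` A : set R).
  by rewrite -[X in measurable X]setTI; exact: oppr_measurable.
by rewrite /pushforward -[X in lebesgue_measure X]setIT -integral_indic.
Qed.

Lemma integral_normal_probN (f : R -> R) :
  measurable_fun setT f -> (forall x, 0 <= f x)%R ->
  \int[normal_prob 0 1]_x (f (- x)%R)%:E = \int[normal_prob 0 1]_x (f x)%:E.
Proof.
move=> mf f0; rewrite !integral_normal_prob//; last exact: measurableT_comp.
rewrite -[RHS]integral_lebesgueN.
- apply: eq_integral => x _; congr (_ * _)%:E.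
  by rewrite !normal_pdfE ?oner_neq0// /normal_fun !subr0 sqrrN.
- by apply: measurable_funM => //; exact: measurable_normal_pdf.
- by move=> x; rewrite mulr_ge0// normal_pdf_ge0.
Qed.

(** For [0 <= t] the excess of the left side over [2] is [(expR t - 1) ^+ 2 / expR t], and
    [expR t - 1 <= t * expR t]. *)
Lemma expRDN_le (t : R) : (expR t + expR (- t) <= 2 + t ^+ 2 * expR `|t|)%R.
Proof.
wlog t0 : t / (0 <= t)%R => [H|].
  have [t0|t0] := leP 0%R t; first exact: H.
  have := H (- t)%R; rewrite opprK sqrrN normrN addrC; apply.
  by rewrite oppr_ge0 ltW.
rewrite ger0_norm// expRN.
have e0 := expR_gt0 t.
have h1 : (1 <= expR t)%R by rewrite -expR0 ler_expR.
have h2 : (expR t - 1 <= t * expR t)%R.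
  have := expR_ge1Dx (- t); rewrite expRN => h.
  have := ler_wpM2r (ltW e0) h; rewrite mulVf ?gt_eqF//.
  by lra.
have e : (expR t + (expR t)^-1 - 2 = (expR t - 1) ^+ 2 / expR t)%R.
  by field; rewrite gt_eqF.
suff : ((expR t - 1) ^+ 2 / expR t <= t ^+ 2 * expR t)%R by rewrite -e; lra.
rewrite ler_pdivrMr// -mulrA -expr2 -exprMn ler_sqr ?nnegrE//; first lra.
by rewrite mulr_ge0// ltW.
Qed.

(* The odd part of [expR (h x)] integrates to [0], which leaves
   [cosh (h x) <= 1 + h x ^+ 2 / 2 * expR `|h x|]. *)
Lemma odd_exp_moment (h : R -> R) (b : R) : (0 <= b)%R ->
  measurable_fun setT h -> (forall x, h (- x) = - h x)%R ->
  (forall x, h x ^+ 2 / 2 * expR `|h x| <= b * expR (x ^+ 2 / 4))%R ->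
  \int[normal_prob 0 1]_x (expR (h x))%:E <= (1 + b * Num.sqrt 2)%:E.
Proof.
move=> b0 mh hN hb.
have me : measurable_fun setT (expR \o h) by exact: measurableT_comp.
have meN : measurable_fun setT (fun x : R => expR (h (- x)%R)).
  by apply: (measurableT_comp me).
set I := \int[_]_x _.
have I0 : 0 <= I by apply: integral_ge0 => x _; rewrite lee_fin expR_ge0.
have II : I + I <= (2 + 2 * b * Num.sqrt 2)%:E.
  rewrite {2}/I -(integral_normal_probN (expR \o h)) => [|//|x]; last exact: expR_ge0.
  rewrite /I -ge0_integralD//; last 3 first.
  - exact/measurable_EFinP.
  - by move=> x _; rewrite lee_fin expR_ge0.
  - exact/measurable_EFinP.
  have mq : measurable_fun setT (fun x : R => expR (x ^+ 2 / 4)).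
    by apply: measurableT_comp => //; apply: measurable_funM.
  apply: (@le_trans _ _ (\int[normal_prob 0 1]_x
      (2 + (2 * b) * expR (x ^+ 2 / 4))%:E)).
    apply: ge0_le_integral_nonmeasurable => x.
      by rewrite -EFinD lee_fin addr_ge0// expR_ge0.
    rewrite -EFinD lee_fin /= hN (le_trans (expRDN_le _))// lerD2l.
    by have := hb x; lra.
  under eq_integral do rewrite EFinD EFinM.
  rewrite ge0_integralD//; last 2 first.
  - by move=> x _; rewrite lee_fin mulr_ge0 ?expR_ge0// mulr_ge0.
  - by apply/measurable_EFinP/measurable_funM.
  rewrite integral_cst//= probability_setT mule1 ge0_integralZl//.
  - by rewrite normal_exp_sqr_moment -EFinM -EFinD.
  - exact/measurable_EFinP.
  - by rewrite lee_fin mulr_ge0.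
move: I0 II; case: I => [r||]//=.
by rewrite -EFinD !lee_fin => _; lra.
Qed.

End GaussianMoments.

(** * Exponential moments of sums over i.i.d. normal variables *)

Section NormalSums.
Context {disp : measure_display} {T : measurableType disp} {R : realType}.
Context {P : probability T R} {d : nat}.
Variable X : 'I_d -> {RV P >-> R}.
Hypothesis iidX : iid_standard_normal X.

Let sqrt2_le : Num.sqrt 2 <= 3 / 2 :> R.
Proof.
have -> : 3 / 2 = `|3 / 2| :> R by rewrite ger0_norm.
by rewrite -sqrtr_sqr ler_sqrt//; lra.
Qed.

Lemma integral_std_normal j (f : R -> R) :
  measurable_fun setT f -> (forall x, 0 <= f x) ->
  (\int[P]_w (f (X j w))%:E = \int[normal_prob 0 1]_x (f x)%:E)%E.
Proof.
move=> mf f0.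
transitivity (\int[P]_w (f (X j w) * 1)%:E)%E.
  by apply: eq_integral => w _; rewrite mulr1.
rewrite (ge0_integral_comp_density P (normal_prob 0 1) (X j) (cst 1) 1)//.
- by rewrite mul1e.
- exact: (@measurable_funPT _ _ _ _ (X j)).
move=> A mA; rewrite mul1e; transitivity (P (X j @^-1` A)); last exact: iidX.2.
under eq_integral do rewrite mulr1.
have mXA : measurable (X j @^-1` A).
  by rewrite -[X in measurable X]setTI; exact: (@measurable_funPT _ _ _ _ (X j)).
by rewrite -[X in P X]setIT -integral_indic.
Qed.

(** The constant is crude: [x ^+ 2 <= 4 * expR (x ^+ 2 / 4)] and [4 * Num.sqrt 2 <= 6]. *)
Lemma sqr_moment_le j : (\int[P]_w (X j w ^+ 2)%:E <= 6%:E)%E.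
Proof.
rewrite (integral_std_normal j (fun x => x ^+ 2)) => [||x]; last 2 first.
- by [].
- exact: sqr_ge0.
have me : measurable_fun setT (fun x : R => expR (x ^+ 2 / 4)).
  by apply: measurableT_comp => //; apply: measurable_funM.
apply: (@le_trans _ _ (\int[normal_prob 0 1]_x (4 * expR (x ^+ 2 / 4))%:E)%E).
  apply: ge0_le_integral_nonmeasurable => x; rewrite lee_fin ?sqr_ge0//.
  by have := expR_ge1Dx (x ^+ 2 / 4); lra.
under eq_integral do rewrite EFinM.
rewrite ge0_integralZl//; last exact/measurable_EFinP.
by rewrite normal_exp_sqr_moment -EFinM lee_fin; have := sqrt2_le; lra.
Qed.

(** By independence the integral is a product. Each factor in [J] is at most
    [1 + b * Num.sqrt 2 <= expR (b * (3 / 2))], and the coordinates outside [J] are given the factor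
    [1]. *)
Lemma sum_exp_moment (J : pred 'I_d) (h : R -> R) (b : R) : 0 <= b ->
  measurable_fun setT h -> (forall x, h (- x) = - h x) ->
  (forall x, h x ^+ 2 / 2 * expR `|h x| <= b * expR (x ^+ 2 / 4)) ->
  (\int[P]_w (expR (\sum_(j | J j) h (X j w)))%:E
     <= (expR (d%:R * (b * (3 / 2))))%:E)%E.
Proof.
move=> b0 mh hN hb.
have me : measurable_fun setT (expR \o h) by exact: measurableT_comp.
pose f j := if J j then expR \o h else cst 1.
have mf j : measurable_fun setT (f j) by rewrite /f; case: (J j).
have f0 j x : 0 <= f j x by rewrite /f; case: (J j) => //=; exact: expR_ge0.
pose I j := (\int[P]_w (f j (X j w))%:E)%E.
have I0 j : (0 <= I j)%E by apply: integral_ge0 => w _; rewrite lee_fin.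
have Ile j : (I j <= (expR (b * (3 / 2)))%:E)%E.
  rewrite /I integral_std_normal// /f; case: (J j) => /=; last first.
    rewrite integral_cst//= probability_setT mule1 lee_fin -expR0 ler_expR.
    by rewrite mulr_ge0// divr_ge0.
  apply: (le_trans (odd_exp_moment h b b0 mh hN hb)); rewrite lee_fin.
  rewrite (le_trans _ (expR_ge1Dx _))// lerD2l ler_wpM2l//.
have Ifin j : I j = (fine (I j))%:E.
  by rewrite fineK// ge0_fin_numE// (le_lt_trans (Ile j))// ltry.
have e w : expR (\sum_(j | J j) h (X j w)) = \prod_j f j (X j w).
  rewrite expR_sum big_mkcond/=; apply: eq_bigr => j _.
  by rewrite /f; case: (J j).
under eq_integral do rewrite e.
rewrite (expectation_prod X iidX.1 f (fun j => fine (I j)))// lee_fin.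
apply: (@le_trans _ _ (\prod_(j < d) expR (b * (3 / 2)))).
  apply: ler_prod => j _; rewrite fine_ge0//=.
  by rewrite -lee_fin -Ifin.
by rewrite prodr_const card_ord -expRM_natl.
Qed.

Let exp_moment_pm (J : pred 'I_d) (h : R -> R) (b : R) : 0 <= b ->
  measurable_fun setT h -> (forall x, h (- x) = - h x) ->
  (forall x, h x ^+ 2 / 2 * expR `|h x| <= b * expR (x ^+ 2 / 4)) ->
  (\int[P]_w (expR (\sum_(j | J j) h (X j w))
             + expR (- \sum_(j | J j) h (X j w)))%:E
     <= (2 * expR (d%:R * (b * (3 / 2))))%:E)%E.
Proof.
move=> b0 mh hN hb.
have mS : measurable_fun setT (fun w => \sum_(j | J j) h (X j w)).
  under eq_fun do rewrite -big_filter.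
  by apply: measurable_sum => j; exact: measurableT_comp.
under eq_integral do rewrite EFinD.
rewrite ge0_integralD//; last 2 first.
- by apply/measurable_EFinP; exact: measurableT_comp.
- by apply/measurable_EFinP; apply: measurableT_comp => //; exact: measurableT_comp.
rewrite mulr2n mulrDl mul1r EFinD leeD//; first exact: sum_exp_moment.
under eq_integral do rewrite -sumrN.
apply: (sum_exp_moment J (fun x => - h x)) => //.
- exact: measurableT_comp.
- by move=> x; rewrite hN.
- by move=> x; rewrite sqrrN normrN.
Qed.

Let sqr_le_expR (x : R) : x ^+ 2 <= 8 * expR (x ^+ 2 / 8).
Proof. by have := expR_ge1Dx (x ^+ 2 / 8); lra. Qed.

(** The square costs [expR (x ^+ 2 / 8)], half of the exponent [x ^+ 2 / 4] that [odd_exp_moment]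
    allows; the other half is kept for [l * |x|]. *)
Let mul_abs_sqr (l y x : R) : 0 <= l -> `|y| <= `|x| ->
  (l * y) ^+ 2 / 2 * expR `|l * y| <= l ^+ 2 * (4 * expR (x ^+ 2 / 8 + l * `|x|)).
Proof.
move=> l0 yx; rewrite normrM (ger0_norm l0) expRD.
have yx2 : y ^+ 2 <= x ^+ 2.
  by rewrite -(real_normK (num_real y)) -(real_normK (num_real x)) ler_sqr ?nnegrE.
have -> : (l * y) ^+ 2 / 2 * expR (l * `|y|) =
  l ^+ 2 * (y ^+ 2 / 2 * expR (l * `|y|)) by ring.
rewrite ler_wpM2l ?sqr_ge0// [leRHS]mulrA.
apply: ler_pM; rewrite ?expR_ge0 ?ler_expR ?ler_wpM2l//.
  by rewrite divr_ge0 ?sqr_ge0.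
by have := sqr_le_expR x; lra.
Qed.

(** Since [(|x| - 2) ^+ 2 >= 0], a tilt [l <= 1 / 2] gives [l * |x| <= x ^+ 2 / 8 + 1 / 2]. With
    [expR (1 / 2) <= 2] this allows [b = 8 * l ^+ 2]. *)
Lemma bounded_tilt_exp_moment (J : pred 'I_d) (q : R -> R) (l : R) :
  measurable_fun setT q -> (forall x, q (- x) = - q x) ->
  (forall x, `|q x| <= `|x|) -> 0 <= l <= 1 / 2 ->
  (\int[P]_w (expR (l * \sum_(j | J j) q (X j w))
             + expR (- (l * \sum_(j | J j) q (X j w))))%:E
     <= (2 * expR (12 * (d%:R * l ^+ 2)))%:E)%E.
Proof.
move=> mq qN qx /andP[l0 l1].
under eq_integral do rewrite mulr_sumr.
have -> : 12 * (d%:R * l ^+ 2) = d%:R * (8 * l ^+ 2 * (3 / 2)) by field.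
apply: (exp_moment_pm J (fun x => l * q x)).
- by rewrite mulr_ge0 ?sqr_ge0.
- exact: measurable_funM.
- by move=> x; rewrite qN mulrN.
move=> x; apply: (le_trans (mul_abs_sqr l (q x) x l0 (qx x))).
rewrite [8 * _]mulrC -[leRHS]mulrA ler_wpM2l ?sqr_ge0//.
have e2 : expR (1 / 2) <= 2 :> R.
  have := expR_ge1Dx (- (1 / 2) : R); rewrite expRN => h.
  have h2 : (2 : R)^-1 <= (expR (1 / 2))^-1 by lra.
  by rewrite lef_pV2 ?posrE ?expR_gt0 in h2.
apply: (@le_trans _ _ (4 * expR (x ^+ 2 / 4 + 1 / 2))).
  rewrite ler_wpM2l// ler_expR.
  have : l * `|x| <= 1 / 2 * `|x| by rewrite ler_wpM2r.
  rewrite -(real_normK (num_real x)).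
  by have := sqr_ge0 (`|x| - 2); nra.
rewrite expRD; have := expR_ge0 (x ^+ 2 / 4); nra.
Qed.

(** Where [q] does not vanish, [x ^+ 2 >= 48 * L] gives [l * |x| <= x ^+ 2 / 12] and
    [2 * L <= x ^+ 2 / 24]. As [1/8 + 1/12 + 1/24 = 1/4], the allowed exponent leaves exactly the
    room for the gain [expR (- (2 * L))]. *)
Lemma tail_exp_moment (J : pred 'I_d) (q : R -> R) (l L : R) :
  measurable_fun setT q -> (forall x, q (- x) = - q x) ->
  (forall x, q x = 0 \/ `|q x| <= `|x| /\ 48 * L <= x ^+ 2) ->
  0 <= l -> 0 <= L -> l ^+ 2 <= L / 4 ->
  (\int[P]_w (expR (l * \sum_(j | J j) q (X j w))
             + expR (- (l * \sum_(j | J j) q (X j w))))%:E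
     <= (2 * expR (6 * (d%:R * (l ^+ 2 * expR (- (2 * L))))))%:E)%E.
Proof.
move=> mq qN qx l0 L0 lL.
under eq_integral do rewrite mulr_sumr.
set b := l ^+ 2 * _.
have b0 : 0 <= b by rewrite mulr_ge0 ?sqr_ge0 ?expR_ge0.
have -> : 6 * (d%:R * b) = d%:R * (4 * b * (3 / 2)) by field.
apply: (exp_moment_pm J (fun x => l * q x)).
- by rewrite mulr_ge0.
- exact: measurable_funM.
- by move=> x; rewrite qN mulrN.
move=> x; case: (qx x) => [->|[qx1 Lx]].
  by rewrite mulr0 expr0n/= !mul0r !mulr_ge0 ?expR_ge0.
apply: (le_trans (mul_abs_sqr l (q x) x l0 qx1)).
have -> : 4 * b * expR (x ^+ 2 / 4) =
  l ^+ 2 * (4 * (expR (- (2 * L)) * expR (x ^+ 2 / 4))) by rewrite /b; ring.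
rewrite ler_wpM2l ?sqr_ge0// ler_wpM2l// -expRD ler_expR.
have lx : l * `|x| <= x ^+ 2 / 12.
  have x2 := sqr_ge0 x.
  rewrite -ler_sqr ?nnegrE; [|exact: mulr_ge0|exact: divr_ge0].
  rewrite !exprMn (real_normK (num_real x)).
  set u := x ^+ 2 in Lx x2 *.
  have : l ^+ 2 * u <= L / 4 * u by rewrite ler_wpM2r.
  have : L * u <= u / 48 * u by rewrite ler_wpM2r//; lra.
  rewrite exprVn; nra.
lra.
Qed.

End NormalSums.

(** * Logarithmic inequalities and growth of the rate *)

Section LogFactor.
Context {R : realType}.
Implicit Types x y a : R.

(** Invert [expR (- (1 / 10)) >= 9 / 10] and raise to the tenth power: [(10 / 9) ^+ 10 <= 3]. *)
Lemma expR1_le3 : expR 1 <= 3 :> R.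
Proof.
have e10 : expR (1 / 10) <= 10 / 9 :> R.
  have := expR_ge1Dx (- (1 / 10) : R); rewrite expRN => h.
  have h2 : (10 / 9 : R)^-1 <= (expR (1 / 10))^-1 by rewrite invf_div; lra.
  by rewrite lef_pV2 ?posrE ?expR_gt0 ?divr_gt0 in h2.
have -> : 1 = 10%:R * (1 / 10) :> R by lra.
rewrite expRM_natl; apply: (@le_trans _ _ ((10 / 9) ^+ 10)).
  by rewrite lerXn2r ?nnegrE ?expR_ge0.
lra.
Qed.

Lemma ln3_ge1 : 1 <= ln 3 :> R.
Proof. by rewrite -[leLHS]expRK ler_ln ?posrE ?expR_gt0// expR1_le3. Qed.

Lemma ln_le_subr1 x : 0 < x -> ln x <= x - 1.
Proof.
move=> x0; have h : -1 < x - 1 by lra.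
by have := le_ln1Dx h; rewrite addrC subrK.
Qed.

(* Tangent lines of [ln] at [1 + t], evaluated at [1] and at [1 + r * t]. *)
Lemma ln1D_mul_le (r t : R) : 1 <= r -> 0 <= t ->
  ln (1 + r * t) <= r * ln (1 + t).
Proof.
move=> r1 t0; have m0 : 0 < 1 + t by lra.
have rt0 : 0 < 1 + r * t by nra.
have h1 : ln (1 + r * t) - ln (1 + t) <= (r - 1) * (t / (1 + t)).
  rewrite -ln_div ?posrE//.
  apply: (le_trans (ln_le_subr1 _ (divr_gt0 rt0 m0))).
  rewrite le_eqVlt; apply/orP; left; apply/eqP; field; lra.
have h2 : t / (1 + t) <= ln (1 + t).
  have := ln_le_subr1 (1 + t)^-1; rewrite invr_gt0 lnV ?posrE// => /(_ m0).
  have -> : (1 + t)^-1 - 1 = - (t / (1 + t)) by field; lra.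
  lra.
nra.
Qed.

(** This is [ln1D_mul_le] with ratio [y / x]. Applied to squares of indices it makes the rate
    [s ^+ 2 * L s] monotone. *)
Lemma mul_ln1D_div_le a x y : 0 <= a -> 0 < x -> x <= y ->
  x * ln (1 + a / x) <= y * ln (1 + a / y).
Proof.
move=> a0 x0 xy; have y0 : 0 < y by lra.
have := @ln1D_mul_le (y / x) (a / y).
rewrite ler_pdivlMr// mul1r => /(_ xy (divr_ge0 a0 (ltW y0))).
have -> : y / x * (a / y) = a / x by field; lra.
move=> /(ler_wpM2l (ltW x0)); rewrite mulrA.
by have -> : x * (y / x) = y by field; lra.
Qed.

Lemma ln_sqrt x : 0 < x -> ln x = 2 * ln (Num.sqrt x).
Proof.
move=> x0; have s0 : 0 < Num.sqrt x by rewrite sqrtr_gt0.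
by rewrite mulr_natl mulr2n -lnM ?posrE// -expr2 sqr_sqrtr// ltW.
Qed.

Lemma ln_le_sqrt4 x : 0 < x -> ln x <= 4 * Num.sqrt x.
Proof.
move=> x0; have s0 : 0 < Num.sqrt x by rewrite sqrtr_gt0.
by rewrite ln_sqrt//; have := ln_le_subr1 _ s0; lra.
Qed.

Variable d : nat.
Hypothesis d3 : (3 <= d)%N.
Local Notation a := (d%:R * ln d%:R : R).

Let dR3 : 3 <= d%:R :> R. Proof. by rewrite (ler_nat R 3). Qed.
Let dR0 : 0 < d%:R :> R. Proof. by rewrite ltr0n (leq_trans _ d3). Qed.

Lemma ln_nat_ge1 : 1 <= ln d%:R :> R.
Proof.
by rewrite (le_trans ln3_ge1)// ler_ln ?posrE.
Qed.

Lemma ln_nat_le : ln d%:R <= d%:R :> R.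
Proof. by apply: (le_trans (ln_le_subr1 _ dR0)); lra. Qed.

Let a_ge : d%:R <= a.
Proof. by rewrite ler_peMr ?ln_nat_ge1// ltW. Qed.

Let a_le : a <= d%:R ^+ 2.
Proof. by rewrite expr2 ler_pM2l// ln_nat_le. Qed.

Let a_gt0 : 0 < a. Proof. exact: lt_le_trans a_ge. Qed.

Variable s : nat.
Hypothesis s1 : (1 <= s)%N.

Let sR1 : 1 <= s%:R :> R. Proof. by rewrite (ler_nat R 1). Qed.
Let s20 : 0 < s%:R ^+ 2 :> R. Proof. by rewrite exprn_gt0// ltr0n. Qed.
Let as20 : 0 < a / s%:R ^+ 2. Proof. exact: divr_gt0. Qed.
Let as2D : 0 < 1 + a / s%:R ^+ 2. Proof. exact: addr_gt0. Qed.

Lemma log_factor_ge0 : 0 <= log_factor d s :> R.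
Proof. by rewrite /log_factor ln_ge0// lerDl ltW. Qed.

Lemma log_factor_anti s' : (s <= s')%N -> log_factor d s' <= log_factor d s :> R.
Proof.
move=> ss'; have sR : s%:R <= s'%:R :> R by rewrite ler_nat.
have s'20 : 0 < s'%:R ^+ 2 :> R by rewrite exprn_gt0// ltr0n (leq_trans s1).
have h : a / s'%:R ^+ 2 <= a / s%:R ^+ 2.
  rewrite ler_pM2l// lef_pV2 ?posrE// ler_sqr ?nnegrE//.
by rewrite /log_factor ler_ln ?posrE ?lerD2l// addr_gt0// divr_gt0.
Qed.

Lemma sqr_log_factor_homo s' : (s <= s')%N ->
  s%:R ^+ 2 * log_factor d s <= s'%:R ^+ 2 * log_factor d s' :> R.
Proof.
move=> ss'; have sR : s%:R <= s'%:R :> R by rewrite ler_nat.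
by apply: mul_ln1D_div_le => //; [exact: ltW | rewrite ler_sqr ?nnegrE].
Qed.

Lemma sqr_log_factor_le : s%:R ^+ 2 * log_factor d s <= d%:R * ln d%:R :> R.
Proof.
have h : -1 < a / s%:R ^+ 2 by rewrite (lt_trans _ as20)// oppr_lt0.
rewrite mulrC -ler_pdivlMr//; exact: le_ln1Dx.
Qed.

Lemma expRN_log_factor_le :
  expR (- log_factor d s) <= s%:R ^+ 2 / (d%:R * ln d%:R) :> R.
Proof.
rewrite expRN /log_factor lnK ?posrE//.
by rewrite -[leRHS]invf_div lef_pV2 ?posrE// lerDr.
Qed.

Let cutoff_sqr : sparsity_cutoff d ^+ 2 = a / 2 :> R.
Proof. by rewrite sqr_sqrtr//; have := a_gt0; lra. Qed.

Let cutoff_ge0 : 0 <= sparsity_cutoff d :> R. Proof. exact: sqrtr_ge0. Qed.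

Lemma truncn_cutoff_lt : (Num.truncn (sparsity_cutoff d : R) < d)%N.
Proof.
rewrite truncn_lt_nat// -ltr_sqr ?nnegrE// cutoff_sqr.
have d20 : 0 < d%:R ^+ 2 :> R by rewrite exprn_gt0.
move: a_le d20; move: a (d%:R ^+ 2 : R) => u v; lra.
Qed.

Let le_cutoff_sqr : s%:R <= sparsity_cutoff d :> R -> s%:R ^+ 2 <= a / 2.
Proof. by move=> h; rewrite -cutoff_sqr ler_sqr ?nnegrE. Qed.

Lemma log_factor_ge1 : s%:R <= sparsity_cutoff d :> R -> 1 <= log_factor d s :> R.
Proof.
move=> /le_cutoff_sqr h; rewrite (le_trans ln3_ge1)// ler_ln ?posrE//.
have : 2 <= a / s%:R ^+ 2 by rewrite ler_pdivlMr// mulrC -ler_pdivlMr.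
by set b := a / _ => ?; lra.
Qed.

(** By monotonicity [s ^+ 2] may be lowered to the real value [a / 2], where the argument of the
    logarithm is exactly [3]. *)
Lemma sqr_log_factor_ge : sparsity_cutoff d < s%:R :> R ->
  d%:R * ln d%:R / 2 <= s%:R ^+ 2 * log_factor d s :> R.
Proof.
move=> h; have h2 : a / 2 <= s%:R ^+ 2.
  by rewrite -cutoff_sqr ler_sqr ?nnegrE// ltW.
have a20 : 0 < a / 2 by rewrite divr_gt0.
apply: (le_trans _ (mul_ln1D_div_le a _ _ (ltW a_gt0) a20 h2)).
have -> : 1 + a / (a / 2) = 3.
  by rewrite invf_div mulrCA divff ?gt_eqF// mulr1; lra.
by rewrite ler_peMr ?ln3_ge1// ltW.
Qed.

(** If [ln d <= 2 * s], then [L s >= 1] suffices. Otherwise [s ^+ 2 <= ln d ^+ 2 / 4 <= Num.sqrt d *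
    ln d], so the ratio inside the logarithm is at least [Num.sqrt d] and [L s >= ln d / 2]. *)
Lemma ln_le_mul_log_factor : s%:R <= sparsity_cutoff d :> R ->
  ln d%:R <= 2 * s%:R * log_factor d s :> R.
Proof.
move=> h; have L1 := log_factor_ge1 h.
have sR := sR1; have d0 := dR0.
have [hs|hs] := leP (ln d%:R) (2 * s%:R : R).
  by apply: (le_trans hs); rewrite ler_peMr// mulr_ge0.
have l1 := ln_nat_ge1; set l : R := ln d%:R in l1 hs *.
suff l2 : l / 2 <= log_factor d s.
  have : l / 2 * 1 <= log_factor d s * s%:R.
    by apply: ler_pM => //; rewrite divr_ge0//; lra.
  by rewrite mulrC [log_factor _ _ * _]mulrC -mulrA; lra.
have -> : l / 2 = ln (Num.sqrt d%:R).
  by rewrite /l ln_sqrt//; lra.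
have r0 : 0 < Num.sqrt d%:R :> R by rewrite sqrtr_gt0.
rewrite /log_factor ler_ln ?posrE//.
suff : Num.sqrt d%:R <= a / s%:R ^+ 2 by set b := a / _ => ?; lra.
rewrite ler_pdivlMr//.
have l4 := ln_le_sqrt4 _ d0; rewrite -/l in l4.
have rr : Num.sqrt d%:R ^+ 2 = d%:R :> R by rewrite sqr_sqrtr ?ltW.
rewrite -/l -[X in _ <= X * _]rr; set r : R := Num.sqrt _ in r0 l4 *.
have h4 : s%:R ^+ 2 <= r * l :> R.
  apply: (@le_trans _ _ (l ^+ 2 / 4)); first by nra.
  by nra.
by rewrite [r ^+ 2]expr2 -[leRHS]mulrA ler_wpM2l// ltW.
Qed.

End LogFactor.

(** Indices past the cutoff satisfy the implication vacuously, so one formula covers the thresholded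
    and the plain sums. *)
Definition keep {R : realType} (alpha : R) (d s : nat) (x : R) : bool :=
  (s%:R <= sparsity_cutoff d :> R) ==> (alpha * log_factor d s < x ^+ 2).

Definition kept {R : realType} (alpha : R) (d s : nat) (x : R) : R :=
  if keep alpha d s x then x else 0.

(** As thresholds decrease with the index, for [1 <= s <= s'] the sum over the observations is the
    estimator at [s'] minus the one at [s]. *)
Definition band {R : realType} (alpha : R) (d s s' : nat) (x : R) : R :=
  if keep alpha d s' x && ~~ keep alpha d s x then x else 0.

(** * Pathwise properties of the selected index *)

Section Selection.
Context {R : realType} {d : nat}.
Variables (alpha beta : R) (theta y : 'rV[R]_d).
Hypothesis d3 : (3 <= d)%N.
Hypothesis alpha48 : 48 < alpha.
Hypothesis beta_ge : 16 / 9 * (Num.sqrt 12 + 2 * Num.sqrt alpha) ^+ 2 <= beta.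

Local Notation N := (Num.truncn (sparsity_cutoff d : R)).
Local Notation L := (log_factor d).
Local Notation z j := (y 0 j - theta 0 j).
Local Notation Lat := (Lhat_at alpha 1 y).
Local Notation adm := (admissible alpha beta 1 y).
Local Notation sh := (shat alpha beta 1 y).

Lemma le_cutoffE s : (s%:R <= sparsity_cutoff d :> R) = (s <= N)%N.
Proof. by rewrite -truncn_ge_nat// sqrtr_ge0. Qed.

Lemma Lhat_atE s : Lat s = \sum_j kept alpha d s (y 0 j).
Proof.
rewrite /Lhat_at /kept /keep; case: ifP => _ //=.
by rewrite big_mkcond/=; under eq_bigr do rewrite expr1n mulr1.
Qed.

Lemma Lhat_at_gt_cutoff s : (N < s)%N -> Lat s = \sum_j y 0 j.
Proof. by rewrite ltnNge -le_cutoffE /Lhat_at => /negbTE ->. Qed.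

Lemma keepS s s' x : (1 <= s)%N -> (s <= s')%N ->
  keep alpha d s x -> keep alpha d s' x.
Proof.
move=> s1 ss' /implyP ks; apply/implyP => hs'.
have hs : s%:R <= sparsity_cutoff d :> R.
  by apply: le_trans hs'; rewrite ler_nat.
apply: le_lt_trans (ks hs); rewrite ler_pM2l; first exact: log_factor_anti.
exact: lt_trans alpha48.
Qed.

Lemma kept_sub_kept s s' x : (1 <= s)%N -> (s <= s')%N ->
  kept alpha d s x - kept alpha d s' x = - band alpha d s s' x.
Proof.
move=> s1 ss'; rewrite /kept /band; have := keepS s s' x s1 ss'.
by case: (keep _ _ s _); case: (keep _ _ s' _) => //=; rewrite ?subrr ?sub0r ?oppr0// => /(_ isT).
Qed.

Lemma shat_spec : sh = N.+1 \/ (1 <= sh <= N)%N /\ adm sh.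
Proof.
rewrite /shat; set r := [seq s <- _ | _].
have : all (fun s => (1 <= s <= N)%N && adm s) r.
  by apply/allP => s; rewrite mem_filter mem_index_iota ltnS => /andP[-> ->].
by case: r => [|s r] /=; [left | case/andP => /andP[]; right].
Qed.

Lemma shat_le s : (1 <= s <= N)%N -> adm s -> (sh <= s)%N.
Proof.
move=> sN as_; rewrite /shat; set r := [seq s <- _ | _].
have sr : s \in r by rewrite mem_filter as_ mem_index_iota ltnS.
have : sorted leq r.
  by apply: sorted_filter; [exact: leq_trans | exact: iota_sorted].
case: r sr => //= h r; rewrite inE => /predU1P[->//|sr].
by move=> /(order_path_min leq_trans)/allP; exact.
Qed.

Lemma admissible_dist s s' : adm s -> (s < s' <= d)%N ->
  `|Lat s - Lat s'| <= omega (d := d) beta 1 s'.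
Proof.
by move=> /allP as_ ss'; apply: as_; rewrite mem_index_iota ltnS.
Qed.

Lemma beta_ge0 : 0 <= beta.
Proof. by apply: le_trans beta_ge; rewrite mulr_ge0// sqr_ge0. Qed.

Lemma omega_sqr s : (1 <= s)%N ->
  omega (d := d) beta 1 s ^+ 2 = beta * (s%:R ^+ 2 * L s).
Proof.
move=> s1; rewrite /omega expr1n mulr1 -mulrA sqr_sqrtr// mulr_ge0 ?beta_ge0//.
by rewrite mulr_ge0 ?sqr_ge0// log_factor_ge0.
Qed.

Let N_lt_d : (N < d)%N. Proof. exact: truncn_cutoff_lt. Qed.
Let d1 : (1 <= d)%N. Proof. exact: leq_trans d3. Qed.

Let sqrD_le (u v : R) : (u + v) ^+ 2 <= 2 * u ^+ 2 + 2 * v ^+ 2.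
Proof. by have := sqr_ge0 (u - v); nra. Qed.

Let sqr_norm_le (u v : R) : `|u| <= v -> u ^+ 2 <= v ^+ 2.
Proof.
move=> uv; rewrite -(real_normK (num_real u)) ler_sqr ?nnegrE//.
exact: le_trans uv.
Qed.

(** A selected index at most [N] is below [d], so its admissibility compares it with the plain sum,
    the estimator at [d]. The default index [N.+1] yields the plain sum itself. *)
Lemma Lhat_sqr_error_le :
  (Lhat alpha beta 1 y - lin_fun theta) ^+ 2 <=
  2 * beta * (d%:R * ln d%:R) + 2 * (\sum_j z j) ^+ 2.
Proof.
have e : \sum_j z j = Lat d - lin_fun theta by rewrite Lhat_at_gt_cutoff// sumrB.
have h : (Lhat alpha beta 1 y - Lat d) ^+ 2 <= beta * (d%:R * ln d%:R).
  rewrite /Lhat; have [->|[/andP[s1 sN] as_]] := shat_spec.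
    rewrite !Lhat_at_gt_cutoff// subrr expr0n/=.
    by rewrite mulr_ge0 ?beta_ge0// mulr_ge0// ltW// (lt_le_trans _ (ln_nat_ge1 d d3)).
  have sd : (sh < d <= d)%N by rewrite leqnn andbT (leq_ltn_trans sN).
  apply: (le_trans (sqr_norm_le _ _ (admissible_dist _ _ as_ sd))).
  by rewrite omega_sqr// ler_wpM2l ?beta_ge0// sqr_log_factor_le.
have := sqrD_le (Lhat alpha beta 1 y - Lat d) (Lat d - lin_fun theta).
rewrite e addrA subrK => /le_trans; apply; rewrite lerD2r.
by rewrite -mulrA ler_wpM2l.
Qed.

Lemma Lhat_sqr_error_le_admissible s : (1 <= s <= N)%N -> adm s ->
  (Lhat alpha beta 1 y - lin_fun theta) ^+ 2 <=
  2 * beta * (s%:R ^+ 2 * L s) + 2 * (Lat s - lin_fun theta) ^+ 2.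
Proof.
move=> sN as_; have /andP[s1 sN1] := sN.
have h : (Lhat alpha beta 1 y - Lat s) ^+ 2 <= beta * (s%:R ^+ 2 * L s).
  rewrite /Lhat; have shs := shat_le _ sN as_.
  have [shE|sh_neq] := eqVneq sh s.
    rewrite shE subrr expr0n/= mulr_ge0 ?beta_ge0// mulr_ge0 ?sqr_ge0//.
    exact: log_factor_ge0.
  rewrite -omega_sqr//; apply: sqr_norm_le.
  (* The default value [N.+1] is excluded, because the selected index is at most [s <= N]. *)
  have [shN|[_ ash]] := shat_spec.
    by move: shs; rewrite shN leqNgt ltnS sN1.
  apply: admissible_dist => //; rewrite ltn_neqAle sh_neq shs/=.
  exact: (leq_trans sN1 (ltnW N_lt_d)).
have := sqrD_le (Lhat alpha beta 1 y - Lat s) (Lat s - lin_fun theta).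
rewrite addrA subrK => /le_trans; apply; rewrite lerD2r.
by rewrite -mulrA ler_wpM2l.
Qed.

End Selection.

(** Cauchy-Schwarz against the constant [1], by expanding the square and using
    [2 * e i * e j <= e i ^+ 2 + e j ^+ 2]. *)
Lemma sqr_sum_le {R : realFieldType} {I : finType} (J : pred I) (e : I -> R) :
  (\sum_(j | J j) e j) ^+ 2 <= #|J|%:R * \sum_(j | J j) e j ^+ 2.
Proof.
rewrite expr2 big_distrlr/=.
apply: (@le_trans _ _ (\sum_(i | J i) \sum_(j | J j) (e i ^+ 2 / 2 + e j ^+ 2 / 2))).
  apply: ler_sum => i _; apply: ler_sum => j _.
  by have := sqr_ge0 (e i - e j); nra.
set Q := \sum_(j | J j) e j ^+ 2.
rewrite (eq_bigr (fun i => #|J|%:R / 2 * e i ^+ 2 + Q / 2)) => [|i _].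
  have -> : \sum_(i | J i) (#|J|%:R / 2 * e i ^+ 2 + Q / 2) =
      #|J|%:R / 2 * Q + #|J|%:R * (Q / 2).
    by rewrite big_split/= -mulr_sumr sumr_const -[X in _ + X = _]mulr_natl.
  by rewrite le_eqVlt; apply/orP; left; apply/eqP; field.
have -> : #|J|%:R / 2 * e i ^+ 2 = #|J|%:R * (e i ^+ 2 / 2) by field.
by rewrite big_split/= sumr_const -[X in X + _ = _]mulr_natl -mulr_suml.
Qed.

(** * Pathwise separation of signal and noise *)

Section SelectionRisk.
Context {R : realType} {d : nat}.
Variables (alpha beta : R) (theta y : 'rV[R]_d).
Hypothesis d3 : (3 <= d)%N.
Hypothesis alpha48 : 48 < alpha.
Hypothesis beta_ge : 16 / 9 * (Num.sqrt 12 + 2 * Num.sqrt alpha) ^+ 2 <= beta.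

Local Notation N := (Num.truncn (sparsity_cutoff d : R)).
Local Notation L := (log_factor d).
Local Notation z j := (y 0 j - theta 0 j).
Local Notation Lat := (Lhat_at alpha 1 y).

Let alpha0 : 0 <= alpha. Proof. by rewrite ltW// (lt_trans _ alpha48). Qed.

Let norm0E : norm0 theta = #|[pred j | theta 0 j != 0]|.
Proof. by rewrite /norm0 cardsE. Qed.

Let keptN_sqr s x : (s <= N)%N -> ~~ keep alpha d s x -> x ^+ 2 <= alpha * L s.
Proof. by rewrite -le_cutoffE /keep => -> /=; rewrite -leNgt. Qed.

(** Off the support the retained observations are pure noise. On it there are at most [s] terms: a
    retained one errs by [z j], a dropped one by [z j - y 0 j], with [y 0 j] below the threshold. *)
Lemma Lhat_at_sqr_error_le s : (1 <= s <= N)%N -> (norm0 theta <= s)%N ->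
  (Lat s - lin_fun theta) ^+ 2 <=
  4 * s%:R * \sum_(j | theta 0 j != 0) z j ^+ 2 + 4 * alpha * (s%:R ^+ 2 * L s)
  + 2 * (\sum_(j | theta 0 j == 0) kept alpha d s (z j)) ^+ 2.
Proof.
move=> /andP[s1 sN] th.
have L0 : 0 <= alpha * L s by rewrite mulr_ge0// log_factor_ge0.
set V := \sum_(j | theta 0 j == 0) _; set Q := \sum_(j | _) z j ^+ 2.
pose e j := kept alpha d s (y 0 j) - theta 0 j.
have -> : Lat s - lin_fun theta = \sum_(j | theta 0 j != 0) e j + V.
  rewrite Lhat_atE -sumrB (bigID [pred j | theta 0 j != 0])/=; congr (_ + _).
  under eq_bigl do rewrite negbK.
  by apply: eq_bigr => j /eqP ->; rewrite !subr0.
have He : (\sum_(j | theta 0 j != 0) e j) ^+ 2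
    <= s%:R * (2 * Q + s%:R * (2 * (alpha * L s))).
  apply: (le_trans (sqr_sum_le _ _)); rewrite -norm0E.
  have ns : (norm0 theta)%:R <= s%:R :> R by rewrite ler_nat.
  apply: ler_pM => //; first by apply: sumr_ge0 => j _; exact: sqr_ge0.
  apply: (@le_trans _ _ (\sum_(j | theta 0 j != 0)
      (2 * z j ^+ 2 + 2 * (alpha * L s)))).
    apply: ler_sum => j _; rewrite /e /kept; case: ifPn => [_|/(keptN_sqr _ _ sN)].
      by have := sqr_ge0 (z j); lra.
    by have := sqr_ge0 (y 0 j - theta 0 j + y 0 j); nra.
  rewrite big_split/= -mulr_sumr lerD2l sumr_const -norm0E -[leLHS]mulr_natl.
  by rewrite ler_wpM2r// mulr_ge0.
have := sqr_ge0 (\sum_(j | theta 0 j != 0) e j - V).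
move: (\sum_(j | theta 0 j != 0) e j) He => E He.
have := He; rewrite !mulrA; nra.
Qed.

(* Observations in the band are at most [Num.sqrt (alpha * L s)] in absolute
   value, so the indices with [theta 0 j != 0] contribute at most
   [Num.sqrt alpha * (s'%:R * Num.sqrt (L s'))] to the distance, and the lower
   bound on [beta] leaves the factor [16] for the noise. *)
Lemma not_admissible_band s : (1 <= s <= N)%N -> (norm0 theta <= s)%N ->
  ~~ admissible alpha beta 1 y s ->
  exists2 s', (s < s' <= N.+1)%N &
    16 * (s'%:R * Num.sqrt (L s')) <=
    `|\sum_(j | theta 0 j == 0) band alpha d s s' (z j)|.
Proof.
move=> /andP[s1 sN] th /allPn[s0]; rewrite mem_index_iota ltnS => /andP[ss0 s0d].
rewrite -ltNge => Hom.
(* All estimators past the cutoff coincide, so a violation found there is moved down to [N.+1]. By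
   monotonicity of the rate, [omega] at [s0] still dominates the scale at [s']. *)
pose s' := minn s0 N.+1.
have ss' : (s < s')%N by rewrite leq_min ss0 ltnS.
have s's0 : (s' <= s0)%N by rewrite geq_minl.
have s'1 : (1 <= s')%N by exact: leq_ltn_trans ss'.
exists s'; first by rewrite ss' geq_minr.
have LatE : Lat s0 = Lat s'.
  rewrite /s'; have [//|Ns0] := leqP s0 N.+1.
  by rewrite !Lhat_at_gt_cutoff// (leq_ltn_trans _ Ns0).
have s0L : s%:R <= sparsity_cutoff d :> R by rewrite le_cutoffE.
have L's0 := log_factor_ge0 d d3 s' s'1 : 0 <= L s' :> R.
have Ls0 := log_factor_ge0 d d3 s s1 : 0 <= L s :> R.
set m : R := s'%:R * Num.sqrt (L s').
have m0 : 0 <= m by rewrite mulr_ge0 ?sqrtr_ge0.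
have m2 : m ^+ 2 = s'%:R ^+ 2 * L s' by rewrite exprMn sqr_sqrtr.
have sb0 : 0 <= Num.sqrt beta by exact: sqrtr_ge0.
have sa0 : 0 <= Num.sqrt alpha by exact: sqrtr_ge0.
have b0 := beta_ge0 alpha beta beta_ge.
have omega_ge : Num.sqrt beta * m <= omega (d := d) beta 1 s0.
  rewrite -(ger0_norm m0) -sqrtr_sqr -sqrtrM// /omega expr1n mulr1 -mulrA.
  apply: ler_wsqrtr; rewrite ler_wpM2l// m2; exact: sqr_log_factor_homo.
have signal : `|\sum_(j | theta 0 j != 0) band alpha d s s' (y 0 j)|
    <= Num.sqrt alpha * m.
  apply: (le_trans (ler_norm_sum _ _ _)).
  apply: (@le_trans _ _ (\sum_(j < d | theta 0 j != 0) Num.sqrt (alpha * L s))).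
    apply: ler_sum => j _; rewrite /band; case: ifPn => [/andP[_ /(keptN_sqr _ _ sN) h]|_].
      by rewrite -sqrtr_sqr; exact: ler_wsqrtr.
    by rewrite normr0 sqrtr_ge0.
  rewrite sumr_const -norm0E -[leLHS]mulr_natl.
  apply: (@le_trans _ _ (s%:R * Num.sqrt (alpha * L s))).
    by rewrite ler_wpM2r ?sqrtr_ge0// ler_nat.
  rewrite sqrtrM// mulrCA ler_wpM2l//.
  rewrite -ler_sqr ?nnegrE// ?mulr_ge0 ?sqrtr_ge0// m2 exprMn sqr_sqrtr//.
  by apply: sqr_log_factor_homo => //; exact: ltnW.
have diff : Lat s - Lat s' = - (\sum_(j | theta 0 j != 0) band alpha d s s' (y 0 j)
    + \sum_(j | theta 0 j == 0) band alpha d s s' (z j)).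
  rewrite !Lhat_atE -sumrB (eq_bigr (fun j => - band alpha d s s' (y 0 j))); last first.
    by move=> j _; rewrite kept_sub_kept// ltnW.
  rewrite sumrN (bigID [pred j | theta 0 j != 0])/=; congr (- (_ + _)).
  under eq_bigl do rewrite negbK.
  by apply: eq_bigr => j /eqP ->; rewrite !subr0.
rewrite LatE diff normrN in Hom.
set E := \sum_(j | theta 0 j != 0) _ in signal Hom.
set U := \sum_(j | _) _ in Hom *.
have HEU := ler_normD E U.
have a48 := alpha48.
(* Rational lower bounds for the roots of [12] and [48]. They suffice because
   [4/3 * 173/50 + 5/3 * 173/25 >= 16], whence [16 + Num.sqrt alpha <= Num.sqrt beta]. *)
have r12 : 173 / 50 <= Num.sqrt 12 :> R.
  have -> : 173 / 50 = Num.sqrt ((173 / 50) ^+ 2) :> R.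
    by rewrite sqrtr_sqr ger0_norm//; lra.
  by rewrite ler_wsqrtr//; lra.
have r48 : 173 / 25 <= Num.sqrt alpha.
  have -> : 173 / 25 = Num.sqrt ((173 / 25) ^+ 2) :> R.
    by rewrite sqrtr_sqr ger0_norm//; lra.
  by rewrite ler_wsqrtr//; lra.
have rb : 4 / 3 * (Num.sqrt 12 + 2 * Num.sqrt alpha) <= Num.sqrt beta.
  have p0 : 0 <= 4 / 3 * (Num.sqrt 12 + 2 * Num.sqrt alpha) by lra.
  rewrite -ler_sqr ?nnegrE//.
  by rewrite sqr_sqrtr//; apply: le_trans beta_ge; rewrite exprMn; lra.
have : (16 + Num.sqrt alpha) * m <= Num.sqrt beta * m.
  by rewrite ler_wpM2r//; lra.
rewrite mulrDl => H.
lra.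
Qed.
End SelectionRisk.

(** Measurability and nonnegativity travel with the bound, so that dominating functions can be added
    and scaled freely. *)
Definition mean_le {disp : measure_display} {T : measurableType disp}
    {R : realType} (P : probability T R) (f : T -> R) (c : R) : Prop :=
  [/\ measurable_fun setT f, forall w, 0 <= f w &
      (\int[P]_w (f w)%:E <= c%:E)%E].

(** Twice the hyperbolic cosine; it dominates [expR |u|] and so controls both tails at once. *)
Definition pmexp {R : realType} (u : R) : R := expR u + expR (- u).

(** * Calculus of bounds on means *)

Section MeanBounds.
Context {disp : measure_display} {T : measurableType disp} {R : realType}.
Variable P : probability T R.
Implicit Types (f g : T -> R) (c : R).

Lemma mean_le_cst c : 0 <= c -> mean_le P (cst c) c.
Proof.
move=> c0; split=> //.
by rewrite (integral_cst P measurableT c%:E)/= probability_setT mule1.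
Qed.

Lemma mean_leD f g c1 c2 : mean_le P f c1 -> mean_le P g c2 ->
  mean_le P (fun w => f w + g w) (c1 + c2).
Proof.
move=> [mf f0 If] [mg g0 Ig]; split=> [|w|].
- exact: measurable_funD.
- exact: addr_ge0.
under eq_integral do rewrite EFinD.
rewrite ge0_integralD// ?EFinD ?leeD//; try exact/measurable_EFinP.
all: by move=> w _; rewrite lee_fin.
Qed.

Lemma mean_leZ f c k : 0 <= k -> mean_le P f c ->
  mean_le P (fun w => k * f w) (k * c).
Proof.
move=> k0 [mf f0 If]; split=> [|w|].
- exact: measurable_funM.
- exact: mulr_ge0.
under eq_integral do rewrite EFinM.
rewrite ge0_integralZl//.
- by rewrite EFinM lee_wpmul2l// lee_fin.
- exact/measurable_EFinP.
- by move=> w _; rewrite lee_fin.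
Qed.

Lemma mean_le_sum (I : Type) (r : seq I) (J : pred I) (f : I -> T -> R)
    (c : I -> R) : (forall i, J i -> mean_le P (f i) (c i)) ->
  mean_le P (fun w => \sum_(i <- r | J i) f i w) (\sum_(i <- r | J i) c i).
Proof.
move=> H; elim: r => [|i r IH].
  rewrite big_nil; under eq_fun do rewrite big_nil.
  exact: mean_le_cst.
rewrite big_cons; under eq_fun do rewrite big_cons.
case: ifPn => Ji; last exact: IH.
by apply: mean_leD => //; exact: H.
Qed.

Lemma mean_le_weaken f c1 c2 : c1 <= c2 -> mean_le P f c1 -> mean_le P f c2.
Proof. by move=> c12 [mf f0 If]; split=> //; rewrite (le_trans If) ?lee_fin. Qed.

Lemma integral_le_mean (h g : T -> R) c : (forall w, 0 <= h w <= g w) ->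
  mean_le P g c -> (\int[P]_w (h w)%:E <= c%:E)%E.
Proof.
move=> hg [_ _]; apply: le_trans.
by apply: ge0_le_integral_nonmeasurable => w; rewrite lee_fin; case/andP: (hg w).
Qed.

End MeanBounds.

(** * Powers and tail events dominated by exponentials *)

Section ExponentialDomination.
Context {R : realType}.
Implicit Types u t : R.

Lemma pmexp_norm u : expR `|u| <= pmexp u.
Proof.
rewrite /pmexp; have [u0|u0] := leP 0 u.
  by rewrite ger0_norm// lerDl expR_ge0.
by rewrite ltr0_norm// lerDr expR_ge0.
Qed.

Lemma pmexp_ge0 u : 0 <= pmexp u.
Proof. by rewrite addr_ge0 ?expR_ge0. Qed.

(** Raise [v <= expR v] to the power [n.+1] at [v = |u| / n.+1]. *)
Let expr_le_pmexp n u : (`|u| / n.+1%:R) ^+ n.+1 <= pmexp u.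
Proof.
apply: le_trans (pmexp_norm u).
have {2}-> : `|u| = n.+1%:R * (`|u| / n.+1%:R) by rewrite mulrC divfK.
rewrite expRM_natl lerXn2r ?nnegrE ?expR_ge0 ?divr_ge0//.
by apply: le_trans (expR_ge1Dx _); rewrite lerDr.
Qed.

Lemma sqr_le_pmexp u : u ^+ 2 <= 4 * pmexp u.
Proof.
have := expr_le_pmexp 1 u; rewrite exprMn (real_normK (num_real u)).
by rewrite exprVn; lra.
Qed.

Lemma expr4_le_pmexp u : u ^+ 4 <= 256 * pmexp u.
Proof.
have := expr_le_pmexp 3 u; rewrite exprMn (exprM _ 2 2) (real_normK (num_real u)).
by rewrite -exprM exprVn; lra.
Qed.

(** Pointwise form of the Chernoff bound: the right side dominates the indicator of the event. *)
Lemma pmexp_ge_tail u t : t <= `|u| -> 1 <= expR (- t) * pmexp u.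
Proof.
move=> tu; rewrite -expR0 -(addNr t) expRD ler_pM2l ?expR_gt0//.
by apply: le_trans (pmexp_norm u); rewrite ler_expR.
Qed.

End ExponentialDomination.

(** * Mean bounds for the noise terms of the selection procedure *)

Section SelectionMoments.
Context {disp : measure_display} {T : measurableType disp} {R : realType}.
Context {P : probability T R} {d : nat}.
Variable X : 'I_d -> {RV P >-> R}.
Hypothesis iidX : iid_standard_normal X.
Hypothesis d3 : (3 <= d)%N.
Variable alpha : R.
Hypothesis alpha48 : 48 < alpha.

Local Notation N := (Num.truncn (sparsity_cutoff d : R)).
Local Notation L := (log_factor d).

Let measurable_keep s : measurable_fun setT (keep alpha d s).
Proof.
rewrite /keep; case: (_ <= _) => //=.
by apply: measurable_fun_ltr => //; exact: exprn_measurable.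
Qed.

Let measurable_kept s : measurable_fun setT (kept alpha d s).
Proof. by apply: measurable_fun_ifT => //; exact: measurable_keep. Qed.

Let measurable_band s s' : measurable_fun setT (band alpha d s s').
Proof.
apply: measurable_fun_ifT => //; apply: measurable_and; first exact: measurable_keep.
by apply: measurable_neg; exact: measurable_keep.
Qed.

Let keptN s x : kept alpha d s (- x) = - kept alpha d s x.
Proof. by rewrite /kept /keep sqrrN; case: ifP; rewrite ?oppr0. Qed.

Let bandN s s' x : band alpha d s s' (- x) = - band alpha d s s' x.
Proof. by rewrite /band /keep sqrrN; case: ifP; rewrite ?oppr0. Qed.

Let band_le s s' x : `|band alpha d s s' x| <= `|x|.
Proof. by rewrite /band; case: ifP; rewrite ?normr0. Qed.

Let measurable_pmexp_sum (J : pred 'I_d) (q : R -> R) (l : R) :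
  measurable_fun setT q ->
  measurable_fun setT (fun w => pmexp (l * \sum_(j | J j) q (X j w))).
Proof.
move=> mq.
have mS : measurable_fun setT (fun w => l * \sum_(j | J j) q (X j w)).
  apply: measurable_funM => //; under eq_fun do rewrite -big_filter.
  by apply: measurable_sum => j; exact: measurableT_comp.
apply: measurable_funD; first exact: measurableT_comp.
by apply: measurableT_comp => //; exact: measurableT_comp.
Qed.

Let dR1 : 1 <= d%:R :> R. Proof. by rewrite (ler_nat R 1) (leq_trans _ d3). Qed.

(** The tilt [l] satisfies [d * l ^+ 2 = 1 / 4], which makes the bound free of [d]. *)
Lemma mean_pmexp_noise :
  mean_le P (fun w => pmexp ((2 * Num.sqrt d%:R)^-1 * \sum_j X j w)) (2 * expR 3).
Proof.
split=> [|w|]; [exact: (measurable_pmexp_sum predT id)|exact: pmexp_ge0|].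
have r1 : 1 <= Num.sqrt d%:R :> R by rewrite -[leLHS]sqrtr1 ler_wsqrtr.
set l := (2 * _)^-1.
have l0 : 0 <= l <= 1 / 2.
  rewrite invr_ge0 mulr_ge0 ?sqrtr_ge0//= div1r lef_pV2 ?posrE//; lra.
have := bounded_tilt_exp_moment X iidX predT id l (@measurable_id _ _ _)
  (fun=> erefl) (fun=> lexx _) l0.
have -> : 12 * (d%:R * l ^+ 2) = 3.
  rewrite exprVn exprMn sqr_sqrtr ?ler0n//; field.
  by rewrite pnatr_eq0 -lt0n (leq_trans _ d3).
by apply.
Qed.

Let l_ge1 : 1 <= ln d%:R :> R. Proof. exact: ln_nat_ge1. Qed.

Let dR0 : 0 < d%:R :> R. Proof. exact: lt_le_trans dR1. Qed.

(** A single factor [expR (- L s)], at most [s ^+ 2 / (d * ln d)], offsets the number [d] of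
    coordinates. *)
Lemma mul_expRN_log_factor_le s : (1 <= s)%N ->
  d%:R * expR (- (2 * L s)) <= s%:R ^+ 2 / ln d%:R :> R.
Proof.
move=> s1; have L0 := log_factor_ge0 d d3 s s1 : 0 <= L s :> R.
have h : expR (- (2 * L s)) <= expR (- L s) :> R by rewrite ler_expR; lra.
have := ler_wpM2l (ltW dR0) (le_trans h (expRN_log_factor_le d d3 s s1)).
by rewrite invfM mulrA mulrCA -mulrA mulKf ?gt_eqF// mulrC.
Qed.

(** The tilt is the inverse of the scale [s]: its square cancels the [s ^+ 2] left by
    [mul_expRN_log_factor_le], so the mean stays bounded. *)
Lemma mean_pmexp_kept (J : pred 'I_d) s : (1 <= s <= N)%N ->
  mean_le P (fun w => pmexp ((2 * s%:R)^-1 * \sum_(j | J j) kept alpha d s (X j w)))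
    (2 * expR 2).
Proof.
move=> /andP[s1 sN].
split=> [|w|]; [exact: measurable_pmexp_sum|exact: pmexp_ge0|].
have sc : s%:R <= sparsity_cutoff d :> R by rewrite le_cutoffE.
have L1 := log_factor_ge1 d d3 s s1 sc.
have sR1 : 1 <= s%:R :> R by rewrite (ler_nat R 1).
set l := (2 * s%:R)^-1.
have l0 : 0 <= l by rewrite invr_ge0 mulr_ge0.
have l2 : l ^+ 2 = (4 * s%:R ^+ 2)^-1 by rewrite exprVn exprMn; congr (_ * _)^-1; lra.
have s21 : 1 <= s%:R ^+ 2 :> R by rewrite exprn_ege1.
have qx x : kept alpha d s x = 0 \/
    `|kept alpha d s x| <= `|x| /\ 48 * L s <= x ^+ 2.
  rewrite /kept /keep sc /=; case: ifPn => [h|_]; [right|by left].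
  split=> //; apply: (le_trans _ (ltW h)); rewrite ler_wpM2r ?ltW//; lra.
have lL : l ^+ 2 <= L s / 4.
  rewrite l2; apply: (@le_trans _ _ 4^-1); last by lra.
  by rewrite lef_pV2 ?posrE//; lra.
have := tail_exp_moment X iidX J _ l (L s) (measurable_kept s) (keptN s) qx l0
  (le_trans ler01 L1) lL.
move=> /le_trans; apply; rewrite lee_fin ler_pM2l// ler_expR.
have h := ler_wpM2l (sqr_ge0 l) (mul_expRN_log_factor_le s s1).
have e : l ^+ 2 * (s%:R ^+ 2 / ln d%:R) <= 1 / 4.
  rewrite l2 invfM -mulrA mulKf ?gt_eqF//; last by lra.
  by rewrite div1r ler_piMr// invf_le1// (lt_le_trans ltr01 l_ge1).
rewrite [d%:R * (l ^+ 2 * _)]mulrCA.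
by move: (le_trans h e); set u := l ^+ 2 * _; lra.
Qed.

(** Up to the cutoff the band omits small values, and the moment bound carries the gain
    [expR (- (2 * L s'))]. At [N.+1] only the bound for small tilts is available. The exponent [3]
    leaves room for summing over up to [d] indices. *)
Lemma mean_band_tail (J : pred 'I_d) s s' : (1 <= s)%N -> (s < s' <= N.+1)%N ->
  exists2 g : T -> R,
    mean_le P g (2 * expR (- ((if (s' <= N)%N then 3 else 2) * ln d%:R))) &
    forall w, 16 * (s'%:R * Num.sqrt (L s')) <=
       `|\sum_(j | J j) band alpha d s s' (X j w)| -> 1 <= g w.
Proof.
move=> s1 /andP[ss' s'N].
have s'1 : (1 <= s')%N by exact: leq_ltn_trans ss'.
have s'R1 : 1 <= s'%:R :> R by rewrite (ler_nat R 1).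
have L0 := log_factor_ge0 d d3 s' s'1 : 0 <= L s' :> R.
have ln1 := l_ge1; set n : R := ln d%:R in ln1 *.
set m : R := s'%:R * Num.sqrt (L s').
have m2 : m ^+ 2 = s'%:R ^+ 2 * L s' by rewrite exprMn sqr_sqrtr.
have m0 : 0 <= m by rewrite mulr_ge0 ?sqrtr_ge0.
(* Here [k * n] is the exponent gained on the event and [c * n] the cost of the exponential moment;
   the two cases use [4 - 1] and [5 - 3]. *)
have tail (l k c : R) : 0 <= l -> k * n <= l * (16 * m) ->
    mean_le P (fun w => pmexp (l * \sum_(j | J j) band alpha d s s' (X j w)))
      (2 * expR (c * n)) ->
    exists2 g : T -> R, mean_le P g (2 * expR (- ((k - c) * n))) &
      forall w, 16 * m <= `|\sum_(j | J j) band alpha d s s' (X j w)| -> 1 <= g w.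
  move=> l0 kl Hm.
  exists (fun w => expR (- (k * n)) *
      pmexp (l * \sum_(j | J j) band alpha d s s' (X j w))).
    have -> : 2 * expR (- ((k - c) * n)) = expR (- (k * n)) * (2 * expR (c * n)).
      by rewrite mulrCA -expRD; congr (_ * expR _); ring.
    by apply: mean_leZ => //; exact: expR_ge0.
  move=> w Hw; apply: pmexp_ge_tail; apply: (le_trans kl).
  by rewrite normrM (ger0_norm l0) ler_wpM2l.
case: ifPn => [s'le|s'gt].
  have sc : s'%:R <= sparsity_cutoff d :> R by rewrite le_cutoffE.
  have L1 := log_factor_ge1 d d3 s' s'1 sc : 1 <= L s' :> R.
  have nL := ln_le_mul_log_factor d d3 s' s'1 sc; rewrite -/n in nL.
  have m_gt0 : 0 < m by rewrite mulr_gt0 ?sqrtr_gt0//; lra.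
  (* This makes [l * (16 * m)] equal to [4 * n]; the condition [l ^+ 2 <= L s' / 4] is then
     [ln_le_mul_log_factor] squared. *)
  set l := n / (4 * m).
  have l0 : 0 <= l by rewrite divr_ge0//; lra.
  have l2 : l ^+ 2 = n ^+ 2 / (16 * (s'%:R ^+ 2 * L s')).
    by rewrite -m2 /l; field; rewrite gt_eqF.
  have -> : 3 = 4 - 1 :> R by lra.
  apply: (tail l) => //.
    by rewrite le_eqVlt; apply/orP; left; apply/eqP; rewrite /l; field; rewrite gt_eqF.
  split=> [|w|]; [exact: measurable_pmexp_sum|exact: pmexp_ge0|].
  have qx x : band alpha d s s' x = 0 \/
      `|band alpha d s s' x| <= `|x| /\ 48 * L s' <= x ^+ 2.
    have := band_le s s' x; rewrite /band /keep sc /=.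
    case: ifPn => [/andP[h _] _|_]; [right|by left].
    by split=> //; apply: (le_trans _ (ltW h)); rewrite ler_wpM2r// ltW.
  have lL : l ^+ 2 <= L s' / 4.
    rewrite l2 ler_pdivrMr; last first.
      by rewrite mulr_gt0// mulr_gt0 ?exprn_gt0//; lra.
    have : n ^+ 2 <= (2 * s'%:R * L s') ^+ 2 by rewrite ler_sqr ?nnegrE//; nra.
    by lra.
  have := tail_exp_moment X iidX J _ l (L s') (measurable_band s s') (bandN s s')
    qx l0 L0 lL.
  move=> /le_trans; apply; rewrite lee_fin ler_pM2l// ler_expR.
  have h := ler_wpM2l (sqr_ge0 l) (mul_expRN_log_factor_le s' s'1).
  have e : l ^+ 2 * (s'%:R ^+ 2 / n) = n / (16 * L s').
    by rewrite l2; field; rewrite !gt_eqF//; lra.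
  have e2 : n / (16 * L s') <= n / 16.
    rewrite ler_wpM2l//; first lra.
    by rewrite lef_pV2 ?posrE//; lra.
  rewrite [d%:R * (l ^+ 2 * _)]mulrCA.
  by move: h; rewrite e; set u := l ^+ 2 * _; set v := n / (16 * _) in e2 * => h; lra.
have s'E : (N < s')%N by rewrite ltnNge.
have sc : sparsity_cutoff d < s'%:R :> R by rewrite ltNge le_cutoffE -ltnNge.
have mL := sqr_log_factor_ge d d3 s' sc; rewrite -m2 -/n in mL.
have d0 := dR0.
(* With [d * l ^+ 2 = n / 4] the moment costs [3 * n], while [m ^+ 2 >= d * n / 2] gives
   [(l * (16 * m)) ^+ 2 >= 32 * n ^+ 2], above [(5 * n) ^+ 2]. *)
set l := Num.sqrt (n / d%:R) / 2.
have l0 : 0 <= l by rewrite divr_ge0 ?sqrtr_ge0.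
have l2 : d%:R * l ^+ 2 = n / 4.
  rewrite /l exprMn sqr_sqrtr; last by rewrite divr_ge0//; lra.
  by field; rewrite gt_eqF.
have -> : - (2 * n) = - ((5 - 3) * n) by ring.
apply: (tail l) => //.
  have n0 : 0 <= 5 * n by lra.
  have lm0 : 0 <= l * (16 * m) by rewrite !mulr_ge0.
  rewrite -ler_sqr ?nnegrE// -(ler_pM2l d0).
  have -> : d%:R * (l * (16 * m)) ^+ 2 = 256 * m ^+ 2 * (d%:R * l ^+ 2) by ring.
  have : d%:R * n / 2 * n <= m ^+ 2 * n by rewrite ler_wpM2r//; lra.
  have n1 : 0 <= n by lra.
  have : 0 <= d%:R * n * n by rewrite !mulr_ge0.
  rewrite l2; move: (m ^+ 2) => M; rewrite expr2.
  by set u := d%:R * n * n; nra.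
split=> [|w|]; [exact: measurable_pmexp_sum|exact: pmexp_ge0|].
have l1 : 0 <= l <= 1 / 2.
  rewrite l0/= ler_pM2r// -[leRHS]sqrtr1 ler_wsqrtr// ler_pdivrMr// mul1r.
  exact: ln_nat_le.
have := bounded_tilt_exp_moment X iidX J _ l (measurable_band s s') (bandN s s')
  (band_le s s') l1.
move=> /le_trans; apply; rewrite lee_fin ler_pM2l// ler_expR l2; lra.
Qed.

End SelectionMoments.

(** * Risk bounds at noise level one *)

Section UnitNoise.
Context {disp : measure_display} {T : measurableType disp} {R : realType}.
Context {P : probability T R} {d : nat}.
Variable X : 'I_d -> {RV P >-> R}.
Hypothesis iidX : iid_standard_normal X.
Hypothesis d3 : (3 <= d)%N.
Variables alpha beta : R.
Hypothesis alpha48 : 48 < alpha.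
Hypothesis beta_ge : 16 / 9 * (Num.sqrt 12 + 2 * Num.sqrt alpha) ^+ 2 <= beta.
Variables (theta : 'rV[R]_d) (s : nat).
Hypothesis s1 : (1 <= s)%N.
Hypothesis sparse : (norm0 theta <= s)%N.

Local Notation N := (Num.truncn (sparsity_cutoff d : R)).
Local Notation L := (log_factor d).
Local Notation a := (d%:R * ln d%:R : R).
Local Notation y w := (observation theta 1 X w).
Local Notation W w := (\sum_j X j w).
Local Notation noise w := (pmexp ((2 * Num.sqrt d%:R)^-1 * W w)).
Local Notation err w := (Lhat alpha beta 1 (y w) - lin_fun theta).

Let dR0 : 0 < d%:R :> R. Proof. by rewrite ltr0n (leq_trans _ d3). Qed.
Let ln1 : 1 <= ln d%:R :> R. Proof. exact: ln_nat_ge1. Qed.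
Let beta0 : 0 <= beta. Proof. exact: beta_ge0 beta_ge. Qed.
Let a0 : 0 <= a.
Proof. by rewrite mulr_ge0 ?ltW// (lt_le_trans ltr01 ln1). Qed.

Let ba0 : 0 <= 2 * beta * a.
Proof. by apply: mulr_ge0 => //; exact: mulr_ge0. Qed.

Let bad0 : 0 <= 2 * beta * a + d%:R ^+ 2.
Proof. by rewrite addr_ge0 ?sqr_ge0. Qed.

Let obsE w j : y w 0 j - theta 0 j = X j w.
Proof. by rewrite mxE mul1r addrAC subrr add0r. Qed.

Let sqrt_dK : Num.sqrt d%:R ^+ 2 = d%:R :> R.
Proof. by rewrite sqr_sqrtr// ltW. Qed.

Let noise_sqr w : W w ^+ 2 <= 16 * (d%:R * noise w).
Proof.
have := sqr_le_pmexp ((2 * Num.sqrt d%:R)^-1 * W w).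
rewrite exprMn exprVn exprMn sqrt_dK => h.
have d4 : 0 <= 2 ^+ 2 * d%:R :> R by rewrite mulr_ge0// ltW.
have := ler_wpM2l d4 h; rewrite mulVKf; last by rewrite gt_eqF// mulr_gt0.
by move=> /le_trans; apply; rewrite le_eqVlt; apply/orP; left; apply/eqP; ring.
Qed.

Let noise_expr4 w : W w ^+ 4 / d%:R ^+ 2 <= 4096 * noise w.
Proof.
have := expr4_le_pmexp ((2 * Num.sqrt d%:R)^-1 * W w).
rewrite exprMn exprVn exprMn (exprM (Num.sqrt _) 2 2) sqrt_dK => h.
have -> : W w ^+ 4 / d%:R ^+ 2 = 16 * ((2 ^+ 4 * d%:R ^+ 2)^-1 * W w ^+ 4).
  by field; rewrite gt_eqF.
have := ler_wpM2l (ler0n R 16) h.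
by move=> /le_trans; apply; rewrite le_eqVlt; apply/orP; left; apply/eqP; ring.
Qed.

Let err_always w : err w ^+ 2 <= 2 * beta * a + 2 * W w ^+ 2.
Proof.
have := Lhat_sqr_error_le alpha beta theta (y w) d3 beta_ge.
by under eq_bigr do rewrite obsE.
Qed.

Lemma risk_gt_cutoff : (N < s)%N ->
  exists2 G : T -> R, mean_le P G ((4 * beta + 128 * expR 3) * (s%:R ^+ 2 * L s)) &
    forall w, err w ^+ 2 <= G w.
Proof.
move=> Ns.
exists (fun w => 2 * beta * a + 32 * d%:R * noise w); last first.
  move=> w; apply: (le_trans (err_always w)); rewrite lerD2l.
  by have := noise_sqr w; rewrite [_ * d%:R * _]mulrAC; lra.
have sc : sparsity_cutoff d < s%:R :> R by rewrite ltNge le_cutoffE -ltnNge.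
have F := sqr_log_factor_ge d d3 s sc : a / 2 <= s%:R ^+ 2 * L s.
apply: (@mean_le_weaken _ _ _ _ _ (2 * beta * a + 32 * d%:R * (2 * expR 3))); last first.
  apply: mean_leD; first by apply: mean_le_cst.
  by apply: mean_leZ; [rewrite mulr_ge0// ltW|exact: mean_pmexp_noise].
have da : d%:R <= a by rewrite ler_peMr// ltW.
have b0 := beta0; have e0 := expR_ge0 (3 : R).
move: F da; move: (s%:R ^+ 2 * L s) a => F u F1 du.
have h1 : beta * u <= beta * (2 * F) by rewrite ler_wpM2l//; lra.
have h2 : d%:R * expR 3 <= (2 * F) * expR 3 by rewrite ler_wpM2r//; lra.
lra.
Qed.

Lemma risk_le_cutoff : (s <= N)%N ->
  exists2 G : T -> R,
    mean_le P G ((10 * beta + 8 * alpha + 52 + 128 * expR 2 + 8192 * expR 3)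
                 * (s%:R ^+ 2 * L s)) &
    forall w, err w ^+ 2 <= G w.
Proof.
move=> sN; have sN1 : (1 <= s <= N)%N by rewrite s1.
have sc : s%:R <= sparsity_cutoff d :> R by rewrite le_cutoffE.
have L1 := log_factor_ge1 d d3 s s1 sc : 1 <= L s :> R.
have sR1 : 1 <= s%:R :> R by rewrite (ler_nat R 1).
(* The range is a premise of the property, so that a function exists for every [s'] and the whole
   family can be chosen at once. *)
pose dominates s' (g : T -> R) : Prop := (s < s' <= N.+1)%N ->
    mean_le P g (2 * expR (- ((if (s' <= N)%N then 3 else 2) * ln d%:R))) /\
    forall w, 16 * (s'%:R * Num.sqrt (L s')) <=
      `|\sum_(j | theta 0 j == 0) band alpha d s s' (X j w)| -> 1 <= g w.
have /choice[g Hg] : forall s', exists g, dominates s' g.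
  move=> s'.
  have [ss'|ss'] := boolP (s < s' <= N.+1)%N; last first.
    by exists (cst 0); rewrite /dominates (negbTE ss').
  have [g g1 g2] := mean_band_tail X iidX d3 alpha alpha48
    [pred j | theta 0 j == 0] s s' s1 ss'.
  by exists g.
pose tail w := \sum_(s.+1 <= s' < N.+2) g s' w.
pose V w := pmexp ((2 * s%:R)^-1 * \sum_(j | theta 0 j == 0) kept alpha d s (X j w)).
pose Q w := \sum_(j | theta 0 j != 0) X j w ^+ 2.
have mQ : mean_le P Q (6 * s%:R).
  apply: (mean_le_weaken P _ (\sum_(j | theta 0 j != 0) 6)).
    rewrite sumr_const -[leLHS]mulr_natr ler_wpM2l// ler_nat.
    by apply: leq_trans sparse; rewrite /norm0 cardsE.
  apply: mean_le_sum => j _; split=> [|w|]; last exact: sqr_moment_le.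
  - by apply: measurable_funX.
  - exact: sqr_ge0.
have mV : mean_le P V (2 * expR 2) by exact: mean_pmexp_kept.
have expRn k : expR (- (k%:R * ln d%:R)) = (d%:R ^+ k)^-1 :> R.
  by rewrite expRN expRM_natl lnK.
(* Fewer than [d] indices up to [N] contribute [2 / d ^+ 3] each, and the last index [N.+1]
   contributes [2 / d ^+ 2]. *)
have mtail : mean_le P tail (4 / d%:R ^+ 2).
  apply: (mean_le_weaken P _ (\sum_(s.+1 <= s' < N.+2)
      2 * expR (- ((if (s' <= N)%N then 3 else 2) * ln d%:R)))); last first.
    rewrite /tail [X in mean_le _ _ X]big_nat_cond.
    under eq_fun do rewrite big_nat_cond.
    apply: mean_le_sum => s'; rewrite andbT ltnS => ss'.
    by have [] := Hg s' ss'.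
  rewrite big_nat_recr ?ltnS//= ltnn (expRn 2).
  rewrite (eq_big_nat _ _ (F2 := fun=> 2 * (d%:R ^+ 3)^-1)) => [|s' /andP[_ s'N]]; last first.
    by rewrite -ltnS s'N (expRn 3).
  rewrite sumr_const_nat -[X in X + _]mulr_natr.
  have h : (N.+1 - s.+1)%:R <= d%:R :> R.
    rewrite ler_nat subSS (leq_trans (leq_subr _ _))// ltnW//.
    exact: truncn_cutoff_lt.
  have c0 : 0 <= 2 * (d%:R ^+ 3)^-1 :> R by rewrite mulr_ge0// invr_ge0 exprn_ge0// ltW.
  have := ler_wpM2l c0 h.
  have -> : 2 * (d%:R ^+ 3)^-1 * d%:R = 2 * (d%:R ^+ 2)^-1 :> R.
    by field; rewrite gt_eqF.
  by set u := _^-1; lra.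
have tail_ge0 w : 0 <= tail w.
  rewrite /tail big_nat_cond sumr_ge0// => s'; rewrite andbT ltnS => ss'.
  by have [[_ ? _] _] := Hg s' ss'.
(* One function covers both cases: the first three terms serve when [s] is admissible, the last two
   when it is not. *)
exists (fun w => (2 * beta + 8 * alpha) * (s%:R ^+ 2 * L s) + 8 * s%:R * Q w
   + 64 * s%:R ^+ 2 * V w + (2 * beta * a + d%:R ^+ 2) * tail w + 4096 * noise w).
  have alpha0 : 0 <= alpha by rewrite ltW// (lt_trans _ alpha48).
  have F0 : 0 <= s%:R ^+ 2 * L s :> R by apply: mulr_ge0; [exact: sqr_ge0 | lra].
  apply: (@mean_le_weaken _ _ _ _ _ ((2 * beta + 8 * alpha) * (s%:R ^+ 2 * L s)
    + 8 * s%:R * (6 * s%:R) + 64 * s%:R ^+ 2 * (2 * expR 2)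
    + (2 * beta * a + d%:R ^+ 2) * (4 / d%:R ^+ 2) + 4096 * (2 * expR 3))); last first.
    have k1 : 0 <= (2 * beta + 8 * alpha) * (s%:R ^+ 2 * L s).
      by apply: mulr_ge0 => //; apply: addr_ge0; apply: mulr_ge0.
    have k2 : 0 <= 8 * s%:R :> R by apply: mulr_ge0.
    have k3 : 0 <= 64 * s%:R ^+ 2 :> R by apply: mulr_ge0 => //; exact: sqr_ge0.
    have k5 : 0 <= 4096 :> R by exact: ler0n.
    exact: (mean_leD _ _ _ _ _ (mean_leD _ _ _ _ _ (mean_leD _ _ _ _ _
      (mean_leD _ _ _ _ _ (mean_le_cst P _ k1) (mean_leZ _ _ _ _ k2 mQ))
      (mean_leZ _ _ _ _ k3 mV)) (mean_leZ _ _ _ _ bad0 mtail))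
      (mean_leZ _ _ _ _ k5 (mean_pmexp_noise X iidX d3))).
  have s2F : s%:R ^+ 2 <= s%:R ^+ 2 * L s :> R by rewrite ler_peMr// sqr_ge0.
  have s21 : 1 <= s%:R ^+ 2 :> R by rewrite exprn_ege1.
  (* As [a <= d ^+ 2], the mean of [tail] reduces the crude bound to a constant. *)
  have h1 : (2 * beta * a + d%:R ^+ 2) * (4 / d%:R ^+ 2) <= 8 * beta + 4.
    rewrite [leLHS]mulrA ler_pdivrMr ?exprn_gt0//.
    have : beta * a <= beta * d%:R ^+ 2.
      by rewrite ler_wpM2l// expr2 ler_wpM2l ?ln_nat_le// ltW.
    by move: a (d%:R ^+ 2 : R) => u v; lra.
  have -> : 8 * s%:R * (6 * s%:R) = 48 * s%:R ^+ 2 :> R by ring.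
  have e2 := expR_ge0 (2 : R); have e3 := expR_ge0 (3 : R).
  have b0 := beta0.
  move: h1 s2F s21; move: (s%:R ^+ 2 : R) (s%:R ^+ 2 * L s) => q F h1 qF q1.
  have h2 : q * expR 2 <= F * expR 2 by rewrite ler_wpM2r.
  have h3 : expR 3 <= F * expR 3 by rewrite ler_peMl//; lra.
  have h4 : beta <= beta * F by rewrite ler_peMr//; lra.
  move: h1; set u := (_ + _) * (4 / _) => h1.
  lra.
move=> w.
have F0 : 0 <= s%:R ^+ 2 * L s :> R by apply: mulr_ge0; [exact: sqr_ge0 | lra].
have alpha0 : 0 <= alpha by rewrite ltW// (lt_trans _ alpha48).
have Q0 : 0 <= Q w by apply: sumr_ge0 => j _; exact: sqr_ge0.
have V0 : 0 <= V w by exact: pmexp_ge0.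
have noise0 : 0 <= noise w by exact: pmexp_ge0.
have [as_|nas] := boolP (admissible alpha beta 1 (y w) s).
  have h1 := Lhat_sqr_error_le_admissible alpha beta theta (y w) d3 beta_ge s sN1 as_.
  have := Lhat_at_sqr_error_le alpha theta (y w) d3 alpha48 s sN1 sparse.
  under eq_bigr do rewrite obsE.
  under [X in _ + 2 * X ^+ 2]eq_bigr do rewrite obsE.
  have Vs : (\sum_(j | theta 0 j == 0) kept alpha d s (X j w)) ^+ 2
      <= 16 * (s%:R ^+ 2 * V w).
    have := sqr_le_pmexp
      ((2 * s%:R)^-1 * \sum_(j | theta 0 j == 0) kept alpha d s (X j w)).
    rewrite -/(V w) exprMn exprVn => h.
    have s2 : 0 < (2 * s%:R) ^+ 2 :> R by rewrite exprn_gt0//; lra.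
    have := ler_wpM2l (ltW s2) h; rewrite mulVKf ?gt_eqF// => /le_trans; apply.
    by rewrite le_eqVlt; apply/orP; left; apply/eqP; ring.
  rewrite -/(Q w) => h2.
  apply: (le_trans h1).
  have t0 : 0 <= (2 * beta * a + d%:R ^+ 2) * tail w.
    exact: mulr_ge0.
  move: (_ * tail w) t0 => t t0.
  move: h2 Vs; move: (Lhat_at _ _ _ _ - _) => E h2 Vs.
  move: F0; move: (s%:R ^+ 2 * L s) h2 => F h2 F0.
  move: h2 Vs noise0; move: (noise w) (V w) (Q w) => n v q h2 Vs n0.
  lra.
have [s' ss'] := not_admissible_band alpha beta theta (y w) d3 alpha48 beta_ge
  s sN1 sparse nas.
under eq_bigr do rewrite obsE.
move=> /(proj2 (Hg s' ss') w) g1.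
have tail1 : 1 <= tail w.
  rewrite /tail (bigD1_seq s') ?iota_uniq//=; last by rewrite mem_index_iota ltnS.
  rewrite (le_trans g1)// lerDl big_seq_cond sumr_ge0// => i.
  by rewrite mem_index_iota ltnS => /andP[si _]; have [[_ ? _] _] := Hg i si.
apply: (le_trans (err_always w)).
have W4 := noise_expr4 w.
(* This splitting avoids integrating a product of [W w ^+ 2] with [tail w]: the quartic part is
   dominated by [noise w], and [d ^+ 2] by [d ^+ 2 * tail w] since [tail w >= 1]. *)
have W2 : 2 * W w ^+ 2 <= W w ^+ 4 / d%:R ^+ 2 + d%:R ^+ 2.
  have := sqr_ge0 (W w ^+ 2 / d%:R - d%:R).
  have -> : (W w ^+ 2 / d%:R - d%:R) ^+ 2 =
      W w ^+ 4 / d%:R ^+ 2 + d%:R ^+ 2 - 2 * W w ^+ 2.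
    by field; rewrite gt_eqF.
  lra.
have c1 : 2 * beta * a + d%:R ^+ 2 <= (2 * beta * a + d%:R ^+ 2) * tail w.
  by rewrite ler_peMr.
have t1 : 0 <= (2 * beta + 8 * alpha) * (s%:R ^+ 2 * L s).
  by rewrite mulr_ge0// addr_ge0// mulr_ge0.
have t2 : 0 <= 8 * s%:R * Q w by rewrite mulr_ge0.
have t3 : 0 <= 64 * s%:R ^+ 2 * V w by rewrite mulr_ge0// mulr_ge0 ?sqr_ge0.
move: c1 t1 t2 t3 W4 W2.
move: ((2 * beta * a + d%:R ^+ 2) * tail w) (_ * (s%:R ^+ 2 * L s)) => u1 u2.
move: (8 * s%:R * Q w) (64 * s%:R ^+ 2 * V w) (W w ^+ 4 / d%:R ^+ 2) => u3 u4 u5.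
move: (2 * beta * a) => u6.
lra.
Qed.

End UnitNoise.

(** * Homogeneity of the estimator in the noise level *)

Section Scaling.
Context {R : realType} {d : nat}.
Variables (alpha beta sigma : R) (y : 'rV[R]_d).
Hypothesis sigma_gt0 : 0 < sigma.

Lemma Lhat_atZ s : Lhat_at alpha sigma (sigma *: y) s = sigma * Lhat_at alpha 1 y s.
Proof.
rewrite /Lhat_at; case: ifP => _; rewrite mulr_sumr; last first.
  by apply: eq_bigr => j _; rewrite mxE.
apply: eq_big => [j|j _]; rewrite mxE//.
by rewrite exprMn expr1n mulr1 mulrAC [_ * sigma ^+ 2]mulrC ltr_pM2l// exprn_gt0.
Qed.

Lemma omegaZ s : omega (d := d) beta sigma s = sigma * omega (d := d) beta 1 s.
Proof.
rewrite /omega expr1n mulr1 -{2}(ger0_norm (ltW sigma_gt0)) -sqrtr_sqr.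
rewrite -sqrtrM ?sqr_ge0//; congr Num.sqrt; ring.
Qed.

Lemma admissibleZ s :
  admissible alpha beta sigma (sigma *: y) s = admissible alpha beta 1 y s.
Proof.
apply: eq_all => s'; rewrite !Lhat_atZ omegaZ -mulrBr normrM.
by rewrite gtr0_norm// ler_pM2l.
Qed.

Lemma LhatZ : Lhat alpha beta sigma (sigma *: y) = sigma * Lhat alpha beta 1 y.
Proof.
rewrite /Lhat Lhat_atZ; congr (_ * Lhat_at _ _ _ _).
by rewrite /shat; under eq_filter do rewrite admissibleZ.
Qed.

End Scaling.


Theorem theorem1 (R : realType) :
  exists d0 : nat, (3 <= d0)%N /\
  forall alpha beta : R,
    48 < alpha ->
    16 / 9 * (Num.sqrt 12 + 2 * Num.sqrt alpha) ^+ 2 <= beta ->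
  exists C : R, 0 < C /\
  forall (d : nat) (sigma : R) (s : nat),
    (d0 <= d)%N -> 0 < sigma -> (1 <= s <= d)%N ->
  forall (disp : measure_display) (T : measurableType disp)
    (P : probability T R) (xi : 'I_d -> {RV P >-> R}),
    iid_standard_normal xi ->
  (ereal_sup
     [set 'E_P[fun w => ((Lhat alpha beta sigma (observation theta sigma xi w)
                          - lin_fun theta) ^+ 2)%R]
     | theta in sparse_class s]
   <= (C * sigma ^+ 2 * s%:R ^+ 2 * log_factor d s)%:E)%E.
Proof.
(* From [3] on, [ln d >= 1], which underlies all bounds on the rate. *)
exists 3; split=> // alpha beta alpha48 beta_ge.
pose C1 := 4 * beta + 128 * expR 3.
pose C2 := 10 * beta + 8 * alpha + 52 + 128 * expR 2 + 8192 * expR 3.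
have b0 : 0 <= beta by exact: beta_ge0 beta_ge.
have a0 : 0 < alpha by exact: lt_trans alpha48.
have e2 := expR_gt0 (2 : R); have e3 := expR_gt0 (3 : R).
have C10 : 0 < C1 by rewrite /C1; lra.
have C20 : 0 < C2 by rewrite /C2; lra.
exists (C1 + C2); split; first exact: addr_gt0.
move=> d sigma s d3 sigma0 /andP[s1 sd] disp T P xi iid.
apply: ge_ereal_sup => _ [theta /= th <-].
have sn0 : sigma != 0 by rewrite gt_eqF.
(* Dividing by [sigma] preserves the support, so the problem with unit noise has the same
   sparsity. *)
pose theta1 : 'rV[R]_d := sigma^-1 *: theta.
have th1 : (norm0 theta1 <= s)%N.
  rewrite (leq_trans _ th)// /norm0; apply: eq_leq; congr #|pred_of_set _|.
  by apply/setP => j; rewrite !inE mxE mulf_eq0 invr_eq0 (negbTE sn0).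
have F0 : 0 <= s%:R ^+ 2 * log_factor d s :> R.
  by rewrite mulr_ge0 ?sqr_ge0// log_factor_ge0.
have [G mG errG] : exists2 G : T -> R,
    mean_le P G ((C1 + C2) * (s%:R ^+ 2 * log_factor d s)) &
    forall w, (Lhat alpha beta 1 (observation theta1 1 xi w) - lin_fun theta1) ^+ 2
      <= G w.
  have [sN|Ns] := leqP s (Num.truncn (sparsity_cutoff d : R)).
    have [G mG errG] := risk_le_cutoff xi iid d3 alpha beta alpha48 beta_ge theta1 s s1 th1 sN.
    exists G => //; apply: mean_le_weaken mG.
    by rewrite ler_wpM2r// lerDr ltW.
  have [G mG errG] := risk_gt_cutoff xi iid d3 alpha beta beta_ge theta1 s Ns.
  exists G => //; apply: mean_le_weaken mG.
  by rewrite ler_wpM2r// lerDl ltW.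
rewrite unlock.
have -> : (C1 + C2) * sigma ^+ 2 * s%:R ^+ 2 * log_factor d s =
  sigma ^+ 2 * ((C1 + C2) * (s%:R ^+ 2 * log_factor d s)) by ring.
have mG' := mean_leZ P _ _ _ (sqr_ge0 sigma) mG.
apply: integral_le_mean mG' => w; rewrite sqr_ge0/=.
have -> : observation theta sigma xi w = sigma *: observation theta1 1 xi w.
  by apply/rowP => j; rewrite !mxE mulrDr mulVKf// mul1r.
have -> : lin_fun theta = sigma * lin_fun theta1.
  by rewrite /lin_fun mulr_sumr; apply: eq_bigr => j _; rewrite mxE mulVKf.
by rewrite LhatZ// -mulrBr exprMn ler_wpM2l ?sqr_ge0.
Qed.
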